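(* Let $\Sigma,\Sigma'\subset\mathbb R^5$ be two quadratic threefolds, each of the form $\{(u,Q_1(u),Q_2(u)):u\in\mathbb R^3\}$ with $Q_1,Q_2$ real quadratic forms on $\mathbb R^3$ such that the pair $(Q_1,Q_2)$ has simple generalized spectrum (the pair may be different for $\Sigma$ and $\Sigma'$), and let $X\subset\Sigma$, $Y\subset\Sigma'$ be finite. Then, for every $\varepsilon>0$, every $1\le p,q\le2$ with $\frac1p+\frac1q\ge1$, and all complex-valued $f,g$ supported on $X,Y$ respectively, $$\|f*g\|_{\ell^2}\ll_{p,q,\varepsilon}(|X||Y|)^{\varepsilon}\|f\|_{\ell^p}\|g\|_{\ell^q}.$$
   Context: Write $Q_j(u)=u^{\mathsf T}A_ju$ with $A_j$ real symmetric. The pair $(Q_1,Q_2)$ has simple generalized spectrum if $A_1$ is positive definite and $A_1^{-1/2}A_2A_1^{-1/2}$ has three distinct eigenvalues. Convolution is $(f*g)(z)=\sum_{x+y=z}f(x)g(y)$; $\ell^p$ norms are with respect to counting measure. *)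

(* Defs.v *)
From HB Require Import structures.
From mathcomp Require Import all_boot all_order all_algebra.
From mathcomp Require Import finmap sesquilinear.
From mathcomp Require Import all_classical all_reals all_analysis.
From mathcomp Require Import complex ring.

Set Implicit Arguments.
Unset Strict Implicit.
Unset Printing Implicit Defensive.

Import Order.TTheory GRing.Theory Num.Theory.

Local Open Scope classical_set_scope.
Local Open Scope ring_scope.

Section QuadraticThreefolds.
Variable R : realType.

Definition quadmx n (A : 'M[R]_n) (u : 'cV[R]_n) : 'M[R]_1 := u^T *m A *m u.

Definition posdefmx n (A : 'M[R]_n) : Prop :=
  A \is symmetricmx /\ forall u : 'cV[R]_n, u != 0 -> 0 < quadmx A u 0 0.

(* A^{-1/2}, i.e. the positive definite B with B^2 = A^{-1}, which is unique
   (posdefmx_sqr_inj below); the default value 0 is only returned if there is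
   no such B. *)
Definition invsqrtmx n (A : 'M[R]_n) : 'M[R]_n :=
  xget 0 [set B | posdefmx B /\ B *m B = invmx A].

Lemma posdefmx_sqr_inj n (B C : 'M[R]_n) :
  posdefmx B -> posdefmx C -> B *m B = C *m C -> B = C.
Proof.
move=> [/is_hermitianmxP symB posB] [/is_hermitianmxP symC posC] BC.
have trB : B^T = B by rewrite {2}symB expr0 scale1r map_mx_id.
have trC : C^T = C by rewrite {2}symC expr0 scale1r map_mx_id.
pose X := B - C; pose Y := B + C.
have trX : X^T = X by rewrite /X linearB /= trB trC.
have XYYX : X *m Y + Y *m X = 0.
  rewrite /X /Y mulmxBl !mulmxDr !mulmxDl !mulmxN BC.
  by apply/matrixP => i j; rewrite !mxE; ring.
have tr0 : \tr (X *m Y *m X) = 0.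
  have : \tr (X *m Y *m X) + \tr (X *m Y *m X) = 0.
    rewrite {1}mxtrace_mulC -mulmxA -linearD /= -mulmxDr.
    by rewrite XYYX mulmx0 linear0.
  by move/eqP; rewrite -mulr2n mulrn_eq0 /= => /eqP.
have diagE i : (X *m Y *m X) i i = quadmx B (col i X) 0 0 + quadmx C (col i X) 0 0.
  have -> : quadmx B (col i X) 0 0 + quadmx C (col i X) 0 0
      = quadmx Y (col i X) 0 0.
    by rewrite /quadmx /Y mulmxDr mulmxDl [RHS]mxE.
  rewrite /quadmx tr_col trX -row_mul !mxE; apply: eq_bigr => k _.
  by rewrite !mxE.
have ge0 M (v : 'cV[R]_n) : (forall u, u != 0 -> 0 < quadmx M u 0 0) ->
    0 <= quadmx M v 0 0.
  move=> posM; have [->|/posM/ltW//] := eqVneq v 0.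
  by rewrite /quadmx mulmx0 mxE.
apply/eqP; rewrite -subr_eq0 -/X; apply/eqP/matrixP => i j.
have : (X *m Y *m X) j j == 0.
  move/eqP: tr0; rewrite /mxtrace psumr_eq0 => [/allP/(_ j)|k _].
    by rewrite mem_index_enum => /(_ isT).
  by rewrite diagE addr_ge0 // ge0.
have [/colP/(_ i)|Xj] := eqVneq (col j X) 0; first by rewrite !mxE.
by rewrite diagE gt_eqF // addr_gt0 // ?posB ?posC.
Qed.

Definition simple_generalized_spectrum (A1 A2 : 'M[R]_3) : Prop :=
  posdefmx A1 /\
  exists s : seq R, [/\ size s = 3%N, uniq s &
    all (eigenvalue (invsqrtmx A1 *m A2 *m invsqrtmx A1)) s].

Definition quadratic_graph (A1 A2 : 'M[R]_3) : set 'cV[R]_5 :=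
  range (fun u : 'cV[R]_3 =>
    col_mx u (col_mx (quadmx A1 u) (quadmx A2 u)) : 'cV[R]_(3 + (1 + 1))).

Definition quadratic_threefold (S : set 'cV[R]_5) : Prop :=
  exists A1 A2 : 'M[R]_3, [/\ A1 \is symmetricmx, A2 \is symmetricmx,
    simple_generalized_spectrum A1 A2 & S = quadratic_graph A1 A2].

End QuadraticThreefolds.

Section Convolution.
Variable R : realType.

(* The sum \sum_(_ \in _) is 0 when infinitely many terms are nonzero; this
   never happens if f or g has finite support. *)
Definition convolution (T : zmodType) (f g : T -> R[i]) (z : T) : R[i] :=
  \sum_(xy \in [set xy : T * T | xy.1 + xy.2 = z]) f xy.1 * g xy.2.

Definition lpnorm (T : choiceType) (p : R) (f : T -> R[i]) : \bar R :=
  ((\esum_(x in [set: T]) (ComplexField.Normc.normc (f x) `^ p)%:E)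
    `^ p^-1)%E.

End Convolution.

(* Main.v *)
Require Import Defs.
From HB Require Import structures.
From mathcomp Require Import all_boot all_order all_algebra.
From mathcomp Require Import finmap sesquilinear.
From mathcomp Require Import all_classical all_reals all_analysis.
From mathcomp Require Import complex.
From mathcomp Require Import zify ring lra.

Set Implicit Arguments.
Unset Strict Implicit.
Unset Printing Implicit Defensive.

Import Order.TTheory GRing.Theory Num.Theory.
Import mathcomp.boot.fintype mathcomp.boot.finset.

Local Open Scope ring_scope.

(** Since p and q are at most 2, the ell^2 norm is bounded by the ell^p and
    ell^q norms, so the case p = q = 2 suffices.  There a power of
    log (|X| |Y|) is lost, and any such power is absorbed by (|X| |Y|)^eps.

    Reduction to energies.  Cutting |f| and |g| into dyadic levels
    ([dyadic_majorant]) costs logarithms and leaves indicator functions of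
    A in X and B in Y.  The equation x + y = x' + y' says x - x' = y' - y, so
    the number of its solutions in A x B is controlled by the additive
    energies of A and of B separately ([sum_density_indic_le]).  What is needed
    is that N points of one threefold have energy O(N^2 log^4 N).

    From energy to corners.  If x + w = y + z on {(u, Q1 u, Q2 u)}, the base
    points form a parallelogram whose sides a and b at x are orthogonal for Q1
    and for Q2.  In coordinates that diagonalise both forms
    ([simultaneous_diagonalization]) this reads
      sum_i g_i a_i b_i = sum_i lam_i g_i a_i b_i = 0,
    with g_i > 0 and distinct lam_i.  Two such relations force
    (g_i a_i b_i)_i onto a fixed line spanned by a vector without zero entry.
    Either all a_i b_i vanish, and then two opposite vertices and the set of i
    with a_i = 0 determine the parallelogram; or none vanishes, and then the
    direction of a determines the direction of b ([generic_pair_direction]).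

    From corners to rich lines.  Charge a corner (x, y, z) of a parallelogram of
    the second kind to the richer of the lines xy and xz.  A line with k of the N points is charged
    at most k^3 times, because the other leg lies on one line with at most k
    points for each choice of x and y; and at most k N times, because that line,
    y and z determine x.  A projection to the plane in general position
    ([generic_projection]) preserves collinearity in both directions, so it
    remains to bound the sum of min(k^3, k N) over the lines spanned by N points
    of the plane.  This follows from a Szemeredi-Trotter bound with logarithmic
    loss ([rich_lines], [truncated_cubes]).

    The incidence bound.  Let A and B be finite sets separated by a vertical
    line, and let l meet A in a and B in b.  A line through a steeper than l and
    a line through b flatter than l cross between a and b, and these two lines
    determine a and b, hence l.  So if t lines of each kind exist for every l,
    then t^2 times the number of lines meeting both sets is at most the number
    of crossings; and at most t (|A| + |B|) lines have fewer than t companions on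
    one side ([spanning_le]).  Bisecting the points log N times gives
    [dyadic_incidences], because two lines cross over at most one of the two
    halves. *)

(** * Incidences between points and lines *)

Section Crossings.
Variables (R : realDomainType) (T : finType) (px py : T -> R).
Variables (m c : {set T} -> R).

Definition height (l : {set T}) (x : R) : R := m l * x + c l.

(** The lines enter as sets [l] of points with slope [m l] and
    intercept [c l]; different sets must lie on different lines. *)
Definition line_family (Lam : {set {set T}}) : Prop :=
  (forall l p, l \in Lam -> p \in l -> py p = height l (px p)) /\
  {in Lam &, forall l l', m l = m l' -> c l = c l' -> l = l'}.

(** Pairs are ordered by slope.  Comparing heights over points of [P],
    instead of locating the intersection point, avoids a division. *)
Definition crossings (Lam : {set {set T}}) (P : {set T}) :
    {set {set T} * {set T}} :=
  [set ll | [&& ll.1 \in Lam, ll.2 \in Lam, m ll.2 < m ll.1,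
     [exists p in P, height ll.1 (px p) < height ll.2 (px p)] &
     [exists q in P, height ll.2 (px q) < height ll.1 (px q)]]].

Lemma crossings_le (Lam : {set {set T}}) (P : {set T}) :
  (#|crossings Lam P| <= #|Lam| ^ 2)%N.
Proof.
rewrite -mulnn -cardsX; apply/subset_leq_card/subsetP => -[l l'].
by rewrite inE in_setX /= => /and5P[-> ->].
Qed.

(** The steeper line of a pair overtakes the other only once, so a pair
    that crosses over [A] cannot cross over a set further to the right. *)
Lemma crossings_split (Lam : {set {set T}}) (A B : {set T}) :
  (forall a b, a \in A -> b \in B -> px a < px b) ->
  (#|crossings Lam A| + #|crossings Lam B| <= #|crossings Lam (A :|: B)|)%N.
Proof.
move=> ltAB.
have dis : crossings Lam A :&: crossings Lam B = set0.
  apply/setP => -[l l']; rewrite !inE /=; apply/negP => /andP[].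
  move=> /and5P[_ _ mm _ /exists_inP[q qA hq]].
  move=> /and5P[_ _ _ /exists_inP[p pB hp] _].
  have lt_qp := ltAB _ _ qA pB; move: hq hp; rewrite /height => hq hp.
  have : 0 < (m l - m l') * (px p - px q) by rewrite mulr_gt0 ?subr_gt0.
  lra.
rewrite -cardsUI dis cards0 addn0.
apply/subset_leq_card/subsetP => -[l l']; rewrite !inE /=.
by move=> /orP[] /and5P[-> -> -> /exists_inP[p pA hp] /exists_inP[q qA hq]] /=;
  apply/andP; split; apply/exists_inP;
  [exists p | exists q | exists p | exists q]; rewrite ?inE ?pA ?qA ?orbT.
Qed.

Definition spanning (Lam : {set {set T}}) (A B : {set T}) : {set {set T}} :=
  [set l in Lam | (A :&: l != set0) && (B :&: l != set0)].

(** Elements of one fibre of [al] have different values of [mu], so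
    their ranks in the fibre are different and at most [t] of them are
    below [t]. *)
Lemma few_low_rank (U : finType) (S : {set U}) (al : U -> T) (mu : U -> R)
  (A : {set T}) (t : nat) :
  (forall l, l \in S -> al l \in A) ->
  {in S &, forall l l', al l = al l' -> mu l = mu l' -> l = l'} ->
  (#|[set l in S | (#|[set l' in S | (al l' == al l) && (mu l < mu l')%R]| < t)%N]|
    <= t * #|A|)%N.
Proof.
move=> alA inj.
pose rk l := #|[set l' in S | (al l' == al l) && (mu l < mu l')%R]|.
have rk_lt l l' : l' \in S -> al l = al l' -> (mu l < mu l')%R -> (rk l' < rk l)%N.
  move=> l'S ael lll; apply: proper_card.
  apply/properP; split.
    apply/subsetP => k; rewrite !inE => /and3P[-> /eqP-> h] /=.
    by rewrite ael eqxx (lt_trans lll h).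
  by exists l'; rewrite !inE l'S ?ltxx ?andbF // ael eqxx.
case: t => [|t].
  by rewrite mul0n leqn0 cards_eq0; apply/eqP/setP => l; rewrite !inE ltn0 andbF.
have -> : (t.+1 * #|A|)%N = #|setX A [set: 'I_t.+1]|.
  by rewrite cardsX cardsT card_ord mulnC.
pose D := [set l in S | (rk l < t.+1)%N].
have rkj : {in D &,
    injective (fun l => (al l, inord (rk l) : 'I_t.+1))}.
  move=> l l'; rewrite !inE => /andP[lS lt] /andP[l'S l't] [ael /(congr1 val)].
  rewrite /= !inordK // => rkE.
  apply: inj => //; case: (ltgtP (mu l) (mu l')) => // h.
    by have := rk_lt l l' l'S ael h; rewrite rkE ltnn.
  by have := rk_lt l' l lS (esym ael) h; rewrite rkE ltnn.
rewrite -(card_in_imset rkj); apply/subset_leq_card/subsetP => y /imsetP[l].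
by rewrite inE => /andP[lS _] ->; rewrite in_setX inE andbT /= alA.
Qed.


(** Every line [l] meeting both sets chooses a point [a] of [A] and a
    point [b] of [B] on it.  Call [l] poor if fewer than [t] of the lines that
    choose [a] are steeper, or fewer than [t] of the lines that choose [b] are
    flatter; there are few poor lines by [few_low_rank].  Every other [l] yields
    [t ^ 2] pairs of a steeper line through [a] and a flatter line through [b].
    Such a pair crosses between [a] and [b], and it determines [a] and [b],
    hence [l]. *)
Lemma spanning_le (Lam : {set {set T}}) (A B : {set T}) (t : nat) :
  line_family Lam -> injective px ->
  (forall a b, a \in A -> b \in B -> px a < px b) ->
  (t ^ 2 * #|spanning Lam A B| <=
     t ^ 3 * (#|A| + #|B|) + #|crossings Lam (A :|: B)|)%N.
Proof.
move=> [onl injl] pxI ltAB; set S := spanning Lam A B.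
have [->|[l0 l0S]] := set_0Vmem S; first by rewrite cards0 muln0.
have [a0 _] : exists a, a \in A :&: l0.
  by move: l0S; rewrite inE => /and3P[_ /set0Pn].
pose al l := odflt a0 [pick a in A :&: l].
pose be l := odflt a0 [pick b in B :&: l].
have alP l : l \in S -> (al l \in A) && (al l \in l).
  rewrite inE => /and3P[_ /set0Pn[a al_] _]; rewrite /al.
  by case: pickP => [x|/(_ a)]; rewrite ?al_ // inE.
have beP l : l \in S -> (be l \in B) && (be l \in l).
  rewrite inE => /and3P[_ _ /set0Pn[a al_]]; rewrite /be.
  by case: pickP => [x|/(_ a)]; rewrite ?al_ // inE.
have SL l : l \in S -> l \in Lam by rewrite inE => /andP[].
clearbody S.
have through p l l' : l \in S -> l' \in S -> p \in l -> p \in l' -> m l = m l' -> l = l'.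
  move=> lS l'S pl pl' mm; apply: injl; rewrite ?SL //.
  have := onl _ _ (SL _ lS) pl; have := onl _ _ (SL _ l'S) pl'.
  by rewrite /height mm => -> /addrI.
have line2 p q l l' : l \in S -> l' \in S -> p \in l -> p \in l' -> q \in l -> q \in l' ->
    px p < px q -> l = l'.
  move=> lS l'S pl pl' ql ql' pq; apply: (through p) => //.
  have := onl _ _ (SL _ lS) pl; have := onl _ _ (SL _ l'S) pl'.
  have := onl _ _ (SL _ lS) ql; have := onl _ _ (SL _ l'S) ql'.
  rewrite /height => -> h1 -> h2; have : (m l - m l') * (px q - px p) = 0.
    transitivity ((m l * px q + c l) - (m l * px p + c l)
      - ((m l' * px q + c l') - (m l' * px p + c l'))); first by ring.
    by rewrite h1 h2 subrr.
  by move/eqP; rewrite mulf_eq0 !subr_eq0 (gt_eqF pq) orbF => /eqP.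
pose up l := [set l' in S | (al l' == al l) && (m l < m l')%R].
pose dn l := [set l' in S | (be l' == be l) && (- m l < - m l')%R].
have few1 : (#|[set l in S | (#|up l| < t)%N]| <= t * #|A|)%N.
  apply: few_low_rank => [l /alP/andP[]//|l l' lS l'S e]; apply: (through (al l)) => //.
    by case/andP: (alP _ lS).
  by case/andP: (alP _ l'S); rewrite e.
have few2 : (#|[set l in S | (#|dn l| < t)%N]| <= t * #|B|)%N.
  apply: few_low_rank => [l /beP/andP[]//|l l' lS l'S e /oppr_inj]; apply: (through (be l)) => //.
    by case/andP: (beP _ lS).
  by case/andP: (beP _ l'S); rewrite e.
pose good := [set l in S | (t <= #|up l|)%N && (t <= #|dn l|)%N].
have many : (t ^ 2 * #|good| <= #|crossings Lam (A :|: B)|)%N.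
  pose trip := [set x : {set T} * ({set T} * {set T}) |
     [&& x.1 \in S, x.2.1 \in up x.1 & x.2.2 \in dn x.1]].
  have tripE : #|trip| = (\sum_(l in S) #|up l| * #|dn l|)%N.
    rewrite -sum1_card (eq_bigl (fun x : {set T} * ({set T} * {set T}) =>
       (x.1 \in S) && (x.2 \in setX (up x.1) (dn x.1)))); last first.
      by case=> l [l1 l2]; rewrite !inE.
    rewrite -(pair_big_dep (mem S) (fun l x => x \in setX (up l) (dn l)) (fun _ _ => 1%N)) /=.
    by apply: eq_bigr => l _; rewrite sum1_card cardsX.
  apply: (@leq_trans #|trip|).
    rewrite tripE mulnC -sum_nat_const big_mkcond [leqRHS]big_mkcond /=.
    apply: leq_sum => l _; rewrite [l \in good]inE; case: (l \in S) => //=.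
    by case: ifP => // /andP[h1 h2]; rewrite -mulnn leq_mul.
  have trI : {in trip &, injective (fun x => x.2)}.
    move=> [l [l1 l2]] [l' [l1' l2']]; rewrite !inE /=.
    move=> /and3P[lS /and3P[_ /eqP al1 _] /and3P[_ /eqP be1 _]].
    move=> /and3P[l'S /and3P[_ /eqP al2 _] /and3P[_ /eqP be2 _]] [e1 e2]; subst l1' l2'.
    case/andP: (alP _ lS) => aA al_l; case/andP: (beP _ lS) => bB be_l.
    case/andP: (alP _ l'S) => _ al_l'; case/andP: (beP _ l'S) => _ be_l'.
    by congr (_, _); apply: (line2 (al l) (be l)); rewrite ?ltAB // -?al1 -?be1 ?al2 ?be2.
  rewrite -(card_in_imset trI); apply/subset_leq_card/subsetP => y /imsetP[[l [l1 l2]]].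
  rewrite inE /= => /and3P[lS]; rewrite [l1 \in _]inE [l2 \in _]inE.
  move=> /and3P[l1S /eqP al1 m1] /and3P[l2S /eqP be2 m2] ->; rewrite inE /=.
  case/andP: (alP _ lS) => aA al_l; case/andP: (beP _ lS) => bB be_l.
  case/andP: (alP _ l1S); rewrite al1 => _ al_l1.
  case/andP: (beP _ l2S); rewrite be2 => _ be_l2.
  have := onl _ _ (SL _ lS) al_l; have := onl _ _ (SL _ lS) be_l.
  have := onl _ _ (SL _ l1S) al_l1; have := onl _ _ (SL _ l2S) be_l2.
  have := ltAB _ _ aA bB; rewrite ltrN2 in m2 *; rewrite /height => ab h1 h2 h3 h4.
  have p1 : 0 < (m l1 - m l) * (px (be l) - px (al l)) by rewrite mulr_gt0 ?subr_gt0.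
  have p2 : 0 < (m l - m l2) * (px (be l) - px (al l)) by rewrite mulr_gt0 ?subr_gt0.
  rewrite !SL //= (lt_trans m2 m1) /=; apply/andP; split; apply/exists_inP.
    exists (al l); rewrite ?inE ?aA //; rewrite -h2 h4 /height.
    by move: h1 p2; rewrite h3; clear; lra.
  exists (be l); rewrite ?inE ?bB ?orbT //; rewrite -h1 h3 /height.
  by move: h2 p1; rewrite h4; clear; lra.
have cover : (#|S| <= #|[set l in S | (#|up l| < t)%N]| +
    #|[set l in S | (#|dn l| < t)%N]| + #|good|)%N.
  apply: leq_trans (leq_add (leq_card_setU _ _) (leqnn _)).
  apply: leq_trans (leq_card_setU _ _); apply/subset_leq_card/subsetP => l lS.
  by rewrite !inE lS /=; case: ltnP => //= h1; case: ltnP.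
apply: (leq_trans (leq_mul (leqnn (t ^ 2)) cover)); rewrite !mulnDr leq_add //.
by rewrite (expnSr t 2) -!mulnA leq_add ?leq_mul.
Qed.

End Crossings.

Section RichLines.
Variables (R : realDomainType) (T : finType) (px py : T -> R).
Variables (m c : {set T} -> R).

Lemma lower_part (P : {set T}) (k : nat) : injective px -> (k <= #|P|)%N ->
  exists A : {set T}, [/\ A \subset P, #|A| = k &
    forall a b, a \in A -> b \in P :\: A -> px a < px b].
Proof.
move=> pxI; elim: k => [|k IH] kP.
  by exists set0; rewrite sub0set cards0; split=> // a b; rewrite inE.
have [A [AP cA ltA]] := IH (ltnW kP).
have [x0 x0P] : exists x, x \in P :\: A.
  by apply/set0Pn; rewrite -card_gt0 cardsD (setIidPr AP) cA subn_gt0.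
case: (Order.TotalTheory.arg_minP px x0P) => y yP ymin.
have y_PA : y \in P :\: A := yP.
exists (y |: A); move: (y_PA); rewrite in_setD => /andP[yA yP']; split.
- by rewrite subUset sub1set yP'.
- by rewrite cardsU1 yA cA.
move=> a b; rewrite !inE negb_or -andbA => /orP[/eqP->|aA] /and3P[nby bA bP].
  have b_PA : b \in P :\: A by rewrite in_setD bA.
  have -> : (px y < px b) = (px y != px b) by rewrite lt_neqAle (ymin b b_PA) andbT.
  apply: contraNneq nby => /pxI->.
  by [].
by apply: ltA => //; rewrite inE bA.
Qed.

(** Bisect [P] by a vertical line.  A line that meets both halves
    contributes one more than the sum of its contributions to the halves, which
    [spanning_le] accounts for, and [crossings_split] makes the crossings of the
    two halves add up to at most those of [P].  Each of the [J] levels of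
    bisection therefore costs one copy of the same bound. *)
Theorem dyadic_incidences (Lam : {set {set T}}) (t J : nat) (P : {set T}) :
  line_family px py m c Lam -> injective px -> (#|P| <= 2 ^ J)%N ->
  (t ^ 2 * \sum_(l in Lam) (#|P :&: l| - 1) <=
     J * (t ^ 3 * #|P| + #|crossings px m c Lam P|))%N.
Proof.
move=> lamP pxI; elim: J P => [|J IH] P cP.
  rewrite mul0n leqn0 muln_eq0; apply/orP; right; rewrite sum_nat_eq0.
  apply/forall_inP => l _; rewrite subn_eq0; apply: leq_trans cP.
  exact/subset_leq_card/subsetIl.
have leP : (#|P|./2 <= #|P|)%N by lia.
have [A [AP cA ltA]] := lower_part pxI leP.
pose B := P :\: A.
have PE : P = A :|: B by rewrite -{1}(setID P A) (setIidPr AP).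
have cB : #|B| = (#|P| - #|P|./2)%N by rewrite cardsD (setIidPr AP) cA.
have cAJ : (#|A| <= 2 ^ J)%N by rewrite cA; move: cP; rewrite expnS; lia.
have cBJ : (#|B| <= 2 ^ J)%N by rewrite cB; move: cP; rewrite expnS; lia.
have cAB : (#|P| = #|A| + #|B|)%N by rewrite cA cB; lia.
have cross := crossings_split m c Lam ltA.
have span := spanning_le t lamP pxI ltA.
rewrite -/B -PE -cAB in cross span.
have split_sum : (\sum_(l in Lam) (#|P :&: l| - 1) <=
   \sum_(l in Lam) (#|A :&: l| - 1) + \sum_(l in Lam) (#|B :&: l| - 1) + #|spanning Lam A B|)%N.
  rewrite /spanning -sum1dep_card big_mkcondr -!big_split /=; apply: leq_sum => l _.
  have : (#|P :&: l| <= #|A :&: l| + #|B :&: l|)%N.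
    by rewrite {1}PE setIUl leq_card_setU.
  rewrite -!card_gt0; case: (#|A :&: l|) => [|x]; case: (#|B :&: l|) => [|y] /=; lia.
have := IH A cAJ; have := IH B cBJ; move: cross span split_sum.
rewrite -/B cAB !mulnDr mulSn; nia.
Qed.

(** The number [n] of lines satisfies
    t^2 n k <= 2 J (t^3 N + n^2) for every [t]; take for [t] the integer part of
    n k / (4 J N), so that the first term on the right is absorbed.  The second
    alternative is the case [t = 0]. *)
Corollary rich_lines (Lam : {set {set T}}) (k J : nat) :
  line_family px py m c Lam -> injective px -> (#|T| <= 2 ^ J)%N ->
  (0 < J)%N -> (2 <= k)%N -> (forall l, l \in Lam -> k <= #|l|)%N ->
  (#|Lam| * k ^ 3 <= 256 * J ^ 3 * #|T| ^ 2)%N \/ (#|Lam| * k <= 4 * J * #|T|)%N.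
Proof.
move=> lamP pxI cT J0 k2 rich; set n := #|Lam|; set N := #|T|.
have [n0|n_gt0] := posnP n; first by left; rewrite n0.
have [N0|N_gt0] := posnP N.
  have [l /rich] : exists l, l \in Lam by apply/set0Pn; rewrite -card_gt0.
  by have := max_card l; rewrite -/N N0; lia.
have inc t : (t ^ 2 * (n * k) <= 2 * J * (t ^ 3 * N + n ^ 2))%N.
  have := @dyadic_incidences Lam t J setT lamP pxI; rewrite cardsT => /(_ cT).
  have : (n * k <= 2 * \sum_(l in Lam) (#|[set: T] :&: l| - 1))%N.
    rewrite /n -sum_nat_const big_distrr /=; apply: leq_sum => l /rich.
    by rewrite setTI; lia.
  have := crossings_le px m c Lam setT; rewrite -/n -/N.
  set S := (\sum_(l in _) _)%N; set cr := #|crossings _ _ _ _ _|.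
  move=> h1 h2 h3; apply: leq_trans (leq_mul (leqnn _) h2) _.
  rewrite mulnCA -mulnA leq_mul2l /=; apply: leq_trans h3 _.
  by rewrite leq_mul2l leq_add2l h1 orbT.
pose t := (n * k %/ (4 * J * N))%N.
have d0 : (0 < 4 * J * N)%N by rewrite !muln_gt0 J0 N_gt0.
have t_le : (t * (4 * J * N) <= n * k)%N := leq_trunc_div _ _.
have t_gt : (n * k < t.+1 * (4 * J * N))%N by rewrite ltn_ceil.
have [t0|t_gt0] := posnP t.
  by right; rewrite t0 mul1n in t_gt; apply: ltnW.
left.
have tk : (t ^ 2 * k <= 4 * J * n)%N.
  have := inc t; have : (2 * J * (t ^ 3 * N) * 2 <= t ^ 2 * (n * k))%N.
    apply: leq_trans (leq_mul (leqnn (t ^ 2)) t_le); rewrite (expnSr t 2); nia.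
  move=> h1 h2; rewrite -(leq_pmul2l n_gt0); nia.
have nk : (n * k <= 8 * J * N * t)%N by nia.
rewrite -(leq_pmul2l n_gt0).
have -> : (n * (n * k ^ 3) = (n * k) ^ 2 * k)%N by ring.
apply: (@leq_trans ((8 * J * N * t) ^ 2 * k)).
  by rewrite leq_mul2r leq_sqr nk orbT.
have -> : ((8 * J * N * t) ^ 2 * k = 64 * J ^ 2 * N ^ 2 * (t ^ 2 * k))%N by ring.
apply: leq_trans (leq_mul (leqnn _) tk) _.
by apply: eq_leq; ring.
Qed.

(** Sort the lines by the dyadic size of [#|l|].  Each alternative of
    [rich_lines] suits one of the two terms of the minimum: [#|l| ^ 3] for the
    first one and [#|l| * #|T|] for the second one. *)
Theorem truncated_cubes (Lam : {set {set T}}) (J : nat) :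
  line_family px py m c Lam -> injective px -> (#|T| <= 2 ^ J)%N ->
  (0 < J)%N -> (forall l, l \in Lam -> 1 < #|l|)%N ->
  (\sum_(l in Lam) minn (#|l| ^ 3) (#|l| * #|T|) <=
     J.+1 * (2048 * J ^ 3 * #|T| ^ 2))%N.
Proof.
move=> [onl injl] pxI cT J0 two; set N := #|T|.
have lt_log (l : {set T}) : (trunc_log 2 #|l| < J.+1)%N.
  rewrite ltnS -[leqRHS](trunc_expnK J (isT : 1 < 2)%N) leq_trunc_log //.
  by apply: leq_trans cT; apply: max_card.
rewrite (partition_big (fun l : {set T} => Ordinal (lt_log l)) xpredT) //=.
rewrite -[J.+1 in leqRHS]card_ord -sum_nat_const; apply: leq_sum => j _.
pose L := [set l in Lam | Ordinal (lt_log l) == j].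
have lamL : line_family px py m c L.
  split=> [l p|l l']; first by rewrite inE => /andP[lL _]; apply: onl.
  by rewrite !inE => /andP[lL _] /andP[l'L _]; apply: injl.
rewrite (eq_bigl (mem L)); last by move=> l; rewrite !inE.
have Lsize l : l \in L -> (0 < j)%N /\ (2 ^ j <= #|l| < 2 ^ j.+1)%N.
  rewrite inE => /andP[lL /eqP <-] /=; have l2 := two _ lL; split.
    by rewrite trunc_log_gt0.
  by rewrite trunc_logP ?(ltnW l2) // trunc_log_ltn.
have [->|[l0 /Lsize[j0 _]]] := set_0Vmem L; first by rewrite big_set0.
have k2 : (2 <= 2 ^ j)%N by rewrite -{1}(expn1 2) leq_exp2l.
have [h|h] := rich_lines lamL pxI cT J0 k2 (fun l lL => proj1 (andP (proj2 (Lsize l lL)))).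
  apply: (@leq_trans (\sum_(l in L) 8 * (2 ^ j) ^ 3)).
    apply: leq_sum => l /Lsize[_ /andP[_ lt_l]]; rewrite geq_min; apply/orP; left.
    have -> : (8 * (2 ^ j) ^ 3 = (2 ^ j.+1) ^ 3)%N by rewrite (expnS 2 j); ring.
    by rewrite leq_exp2r // ltnW.
  rewrite sum_nat_const; rewrite -/N in h *; nia.
apply: (@leq_trans (\sum_(l in L) 2 * 2 ^ j * N)).
  apply: leq_sum => l /Lsize[_ /andP[_ lt_l]]; rewrite geq_min; apply/orP; right.
  by rewrite leq_mul2r -expnS (ltnW lt_l) orbT.
rewrite sum_nat_const; rewrite -/N in h *.
have -> : (#|L| * (2 * 2 ^ j * N) = (#|L| * 2 ^ j) * (2 * N))%N by ring.
apply: leq_trans (leq_mul h (leqnn _)) _.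
have -> : (4 * J * N * (2 * N) = 8 * J * N ^ 2)%N by ring.
by rewrite leq_mul // leq_mul // -{1}(expn1 J) leq_pexp2l.
Qed.

End RichLines.

(** * Corners in the plane *)

Section Corners.
Variables (R : realFieldType) (T : finType) (px py : T -> R).
Hypothesis pxI : injective px.

Definition line_through (x y : T) : {set T} :=
  [set z | (py z - py x) * (px y - px x) == (py y - py x) * (px z - px x)].

Definition connecting_lines : {set {set T}} :=
  [set line_through p.1 p.2 | p in [set p : T * T | p.1 != p.2]].

Lemma line_through_l x y : x \in line_through x y.
Proof. by rewrite inE !subrr mul0r mulr0. Qed.

Lemma line_through_r x y : y \in line_through x y.
Proof. by rewrite inE. Qed.

Lemma connecting_lines_family :
  exists m c : {set T} -> R, line_family px py m c connecting_lines.
Proof.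
pose slope (p : T * T) := (py p.2 - py p.1) / (px p.2 - px p.1).
pose ends (l : {set T}) := [pick p : T * T | (p.1 != p.2) && (l == line_through p.1 p.2)].
pose m l := if ends l is Some p then slope p else 0.
pose c l := if ends l is Some p then py p.1 - slope p * px p.1 else 0.
have mem l : l \in connecting_lines ->
    forall z, (z \in l) = (py z == height m c l (px z)).
  case/imsetP => p; rewrite inE => pne lE z.
  rewrite /height /m /c /ends; case: pickP => [q|/(_ p)]; last by rewrite pne lE eqxx.
  case/andP=> qne /eqP ->; rewrite inE.
  have d0 : px q.2 - px q.1 != 0 by rewrite subr_eq0 (inj_eq pxI) eq_sym.
  rewrite -[RHS](inj_eq (mulIf d0)) -[LHS]subr_eq0 -[RHS]subr_eq0.
  by congr (_ == 0); rewrite /slope; field.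
exists m, c; split=> [l p lL|l l' lL l'L mE cE]; first by rewrite (mem _ lL) => /eqP.
by apply/setP => z; rewrite !mem // /height mE cE.
Qed.

Lemma connecting_lines_gt1 l : l \in connecting_lines -> (1 < #|l|)%N.
Proof.
case/imsetP => p; rewrite inE => pne ->; apply/card_gt1P.
by exists p.1, p.2; rewrite line_through_l line_through_r.
Qed.

Variable corner : T -> T -> T -> bool.
Hypothesis cornerC : forall x y z, corner x y z -> corner x z y.
Hypothesis corner_ne : forall x y z, corner x y z -> x != y.
Hypothesis corner_line : forall x y z z', corner x y z -> corner x y z' ->
  z' \in line_through x z.
Hypothesis corner_inj : forall x x' y z, corner x y z -> corner x' y z ->
  line_through x y = line_through x' y -> x = x'.

(** After exchanging [y] and [z] if necessary, the line through [x] and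
    [y] is at least as rich as the line through [x] and [z].  For a fixed first
    line [l] the corners number at most [#|l| ^ 3], because [z] runs over a line
    with at most [#|l|] points once [x] and [y] are given, and at most
    [#|l| * #|T|], because [y] and [z] determine [x]. *)
Theorem corners_le (J : nat) : (#|T| <= 2 ^ J)%N -> (0 < J)%N ->
  (#|[set q : T * T * T | corner q.1.1 q.1.2 q.2]| <=
     2 * (J.+1 * (2048 * J ^ 3 * #|T| ^ 2)))%N.
Proof.
move=> cT J0; have [m [c lamP]] := connecting_lines_family.
apply: leq_trans (leq_mul (leqnn 2) (truncated_cubes lamP pxI cT J0 connecting_lines_gt1)).
pose C1 := [set q : T * T * T | corner q.1.1 q.1.2 q.2 &&
   (#|line_through q.1.1 q.2| <= #|line_through q.1.1 q.1.2|)%N].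
pose C2 := [set q : T * T * T | corner q.1.1 q.1.2 q.2 &&
   (#|line_through q.1.1 q.1.2| <= #|line_through q.1.1 q.2|)%N].
pose swap (q : T * T * T) := (q.1.1, q.2, q.1.2).
have swapI : injective swap by move=> [[x y] z] [[x' y'] z'] [-> -> ->].
(* Exchanging the two legs maps C2 into C1. *)
have C21 : (#|C2| <= #|C1|)%N.
  rewrite -(card_imset _ swapI); apply/subset_leq_card/subsetP => q' /imsetP[q].
  by rewrite !inE => /andP[/cornerC h1 h2] ->; rewrite h1.
have C12 : (#|[set q : T * T * T | corner q.1.1 q.1.2 q.2]| <= 2 * #|C1|)%N.
  rewrite mul2n -addnn; apply: leq_trans (leq_add (leqnn _) C21).
  apply: leq_trans (leq_card_setU _ _); apply/subset_leq_card/subsetP => q.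
  by rewrite !inE => -> /=; apply: leq_total.
apply: leq_trans C12 _; rewrite leq_mul2l /=.
rewrite -[#|C1|]sum1_card (partition_big (fun q : T * T * T => line_through q.1.1 q.1.2)
  (mem connecting_lines)) /=; last first.
  move=> q; rewrite inE => /andP[/corner_ne ne _].
  by apply: (imset_f (fun p : T * T => line_through p.1 p.2)); rewrite inE.
apply: leq_sum => l _.
pose K := [set q in C1 | line_through q.1.1 q.1.2 == l].
have -> : (\sum_(q in C1 | line_through q.1.1 q.1.2 == l) 1 = #|K|)%N.
  by rewrite -sum1_card; apply: eq_bigl => q; rewrite !inE.
rewrite leq_min; apply/andP; split.
  have -> : #|K| = (\sum_(p in setX l l) #|[set z | (p, z) \in K]|)%N.
    rewrite -[#|K|]sum1_card (partition_big (fun q : T * T * T => q.1) (mem (setX l l))) /=.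
      apply: eq_bigr => p _; rewrite -[RHS]sum1_card.
      rewrite (reindex_onto (fun z => (p, z)) (fun q : T * T * T => q.2)) /=.
        by apply: eq_bigl => z; rewrite !inE !eqxx !andbT.
      by move=> [p' z] /andP[_ /eqP/= ->].
    move=> q; rewrite !inE => /andP[_ /eqP <-].
    move: (line_through_l q.1.1 q.1.2) (line_through_r q.1.1 q.1.2).
    by rewrite !inE => -> ->.
  rewrite (expnSr _ 2) -mulnn -cardsX -sum_nat_const; apply: leq_sum => p _.
  have [->|[z0]] := set_0Vmem [set z | (p, z) \in K]; first by rewrite cards0.
  rewrite !inE /= => /andP[/andP[c0 le0] /eqP pl]; rewrite -pl.
  apply: leq_trans le0; apply/subset_leq_card/subsetP => z.
  by rewrite 3!inE /= => /andP[/andP[cz _] _]; apply: corner_line c0 cz.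
rewrite -[X in (_ <= _ * X)%N]cardsT -cardsX.
pose fg (q : T * T * T) := (q.1.2, q.2).
have fgI : {in K &, injective fg}.
  move=> [[x y] z] [[x' y'] z']; rewrite !inE /= => /andP[/andP[h _] /eqP lE].
  move=> /andP[/andP[h' _] /eqP lE'] [e1 e2]; subst y' z'.
  by rewrite (corner_inj h h') // lE lE'.
rewrite -(card_in_imset fgI); apply/subset_leq_card/subsetP => r /imsetP[q].
rewrite inE => /andP[_ /eqP <-] ->.
by rewrite in_setX in_setT andbT line_through_r.
Qed.

End Corners.

(** * Projections in general position *)

Section GenericProjection.
Variables (R : realFieldType) (n : nat).

(** The linear form with coefficients 1, t, t^2, ...: as a function
    of [t] it is a polynomial, which is nonzero when [u] is. *)
Definition moment_form (t : R) (u : 'rV[R]_n) : R := (rVpoly u).[t].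

Lemma moment_formB t u w : moment_form t (u - w) = moment_form t u - moment_form t w.
Proof. by rewrite /moment_form linearB hornerD hornerN. Qed.

Lemma moment_formZ t k u : moment_form t (k *: u) = k * moment_form t u.
Proof. by rewrite /moment_form linearZ hornerZ. Qed.

Lemma generic_moment_form (s : seq 'rV[R]_n) :
  0 \notin s -> exists t, forall u, u \in s -> moment_form t u != 0.
Proof.
move=> s0; pose P := \prod_(u <- s) rVpoly u.
have P0 : P != 0.
  rewrite prodf_seq_neq0; apply/allP => u us /=; apply: contraNneq s0 => u0.
  by rewrite -(rVpolyK u) u0 linear0 in us.
(* More integers than the degree of P, so one of them is not a root. *)
pose rs := [seq i%:R : R | i <- iota 0 (size P)].
have [t trs tP] : exists2 t, t \in rs & ~~ root P t.
  apply/hasP; rewrite has_predC; apply/negP => all_root.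
  have urs : uniq rs by rewrite map_inj_uniq ?iota_uniq // => i j /eqP; rewrite eqr_nat => /eqP.
  by have := max_poly_roots P0 all_root urs; rewrite size_map size_iota ltnn.
exists t => u us; apply: contraNneq tP => u0.
rewrite /root /P horner_prod prodf_seq_eq0; apply/hasP.
by exists u => //=; apply/eqP.
Qed.

(** The first form has to separate the points.  Given it, the points
    [x], [y], [z] are collinear exactly when a certain vector vanishes, and
    their images are collinear exactly when the second form kills it; so the
    second form is chosen to be nonzero on the finitely many nonzero vectors of
    this kind. *)
Lemma generic_projection (T : finType) (v : T -> 'rV[R]_n) : injective v ->
  exists s t : R, injective (fun x => moment_form s (v x)) /\
    forall x y z, x != y ->
      z \in line_through (fun u => moment_form s (v u)) (fun u => moment_form t (v u)) x y ->
      exists k, v z - v x = k *: (v y - v x).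
Proof.
move=> vI.
have [|s sP] := @generic_moment_form [seq v p.2 - v p.1 | p <- enum [set p : T * T | p.1 != p.2]].
  apply/mapP => -[p]; rewrite mem_enum inE => ne /esym/eqP.
  by rewrite subr_eq0 (inj_eq vI) eq_sym (negbTE ne).
have sne x y : x != y -> moment_form s (v y - v x) != 0.
  by move=> ne; apply/sP/mapP; exists (x, y); rewrite ?mem_enum ?inE.
(* The points x, y, z of q are collinear exactly when w q = 0. *)
pose w (q : T * T * T) := moment_form s (v q.1.2 - v q.1.1) *: (v q.2 - v q.1.1)
   - moment_form s (v q.2 - v q.1.1) *: (v q.1.2 - v q.1.1).
have [|t tP] := @generic_moment_form [seq w q | q <- enum [set q | w q != 0]].
  by apply/mapP => -[q]; rewrite mem_enum inE => /eqP ne /esym.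
exists s, t; split.
  move=> x y /= exy; apply/eqP; apply: contraT => /sne.
  by rewrite moment_formB exy subrr eqxx.
move=> x y z /sne ne; rewrite inE -!moment_formB => /eqP h.
have w0 : w (x, y, z) = 0.
  apply/eqP; apply: contraT => wn.
  have /tP : w (x, y, z) \in [seq w q | q <- enum [set q | w q != 0]].
    by apply: map_f; rewrite mem_enum inE.
  by rewrite /w /= moment_formB !moment_formZ mulrC h mulrC subrr eqxx.
exists (moment_form s (v z - v x) / moment_form s (v y - v x)).
apply: (scalerI ne); rewrite scalerA mulrCA divff // mulr1.
by apply/eqP; rewrite -subr_eq0; apply/eqP.
Qed.

End GenericProjection.

(** The vectors orthogonal to (1, 1, 1) and to [lam] are the multiples
    of their cross product, whose entries are the differences of the [lam i]. *)
Lemma two_relations_line (R : fieldType) (lam : 'I_3 -> R) : injective lam ->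
  exists kap : 'I_3 -> R, (forall i, kap i != 0) /\
    forall pi : 'I_3 -> R, \sum_i pi i = 0 -> \sum_i lam i * pi i = 0 ->
      exists k, forall i, pi i = k * kap i.
Proof.
move=> lamI; pose i0 : 'I_3 := ord0; pose i1 := lift i0 ord0 : 'I_3; pose i2 : 'I_3 := ord_max.
have i3 (P : 'I_3 -> Prop) : P i0 -> P i1 -> P i2 -> forall i, P i.
  move=> h0 h1 h2 [[|[|[|//]]] hi].
  - by rewrite (_ : Ordinal hi = i0) //; apply: val_inj.
  - by rewrite (_ : Ordinal hi = i1) //; apply: val_inj.
  - by rewrite (_ : Ordinal hi = i2) //; apply: val_inj.
have sum3 (F : 'I_3 -> R) : \sum_i F i = F i0 + F i1 + F i2.
  rewrite !big_ord_recr big_ord0 /= add0r; congr (F _ + F _ + F _); exact: val_inj.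
have ne i j : i != j -> lam i - lam j != 0 by rewrite subr_eq0 (inj_eq lamI).
exists (fun i => if i == i0 then lam i1 - lam i2 else if i == i1 then lam i2 - lam i0
   else lam i0 - lam i1); split.
  by apply: i3; rewrite /= ?ne.
move=> pi; rewrite !sum3 => e1 e2; exists (pi i0 / (lam i1 - lam i2)).
have d := ne i1 i2 isT.
have p1 : pi i1 * (lam i1 - lam i2) = pi i0 * (lam i2 - lam i0).
  apply/eqP; rewrite -subr_eq0; apply/eqP.
  transitivity ((lam i0 * pi i0 + lam i1 * pi i1 + lam i2 * pi i2)
    - lam i2 * (pi i0 + pi i1 + pi i2)).
    by ring.
  by rewrite e1 e2 mulr0 subrr.
have p2 : pi i2 * (lam i1 - lam i2) = pi i0 * (lam i0 - lam i1).
  apply/eqP; rewrite -subr_eq0; apply/eqP.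
  transitivity (lam i1 * (pi i0 + pi i1 + pi i2)
    - (lam i0 * pi i0 + lam i1 * pi i1 + lam i2 * pi i2)).
    by ring.
  by rewrite e1 e2 mulr0 subrr.
apply: i3; rewrite /=; apply: (mulIf d).
- by field.
- by rewrite p1; field.
- by rewrite p2; field.
Qed.

(** * Parallelograms orthogonal for two diagonal forms *)

Section Parallelograms.
Variables (R : realFieldType) (g lam : 'I_3 -> R).
Hypothesis g_gt0 : forall i, 0 < g i.
Hypothesis lamI : injective lam.

Definition diag_form (g : 'I_3 -> R) (a b : 'rV[R]_3) : R :=
  \sum_i g i * (a 0 i * b 0 i).

Definition biorthogonal (a b : 'rV[R]_3) : bool :=
  (diag_form g a b == 0) && (diag_form (fun i => lam i * g i) a b == 0).

Definition generic_pair (a b : 'rV[R]_3) : bool :=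
  [forall i, a 0 i * b 0 i != 0] && biorthogonal a b.

Lemma generic_pairC a b : generic_pair a b -> generic_pair b a.
Proof.
rewrite /generic_pair /biorthogonal /diag_form.
have e (h : 'I_3 -> R) : \sum_i h i * (a 0 i * b 0 i) = \sum_i h i * (b 0 i * a 0 i).
  by apply: eq_bigr => i _; rewrite [a 0 i * _]mulrC.
rewrite !e => /andP[/forallP ne ->]; rewrite andbT.
by apply/forallP => i; rewrite mulrC ne.
Qed.

Lemma biorthogonal_profile : exists kap : 'I_3 -> R, (forall i, kap i != 0) /\
  forall a b, biorthogonal a b -> exists k, forall i, g i * (a 0 i * b 0 i) = k * kap i.
Proof.
have [kap [kap0 kapP]] := two_relations_line lamI.
exists kap; split=> // a b /andP[/eqP e1 /eqP e2].
apply: (kapP (fun i => g i * (a 0 i * b 0 i)) e1).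
by rewrite -[RHS]e2 /diag_form; apply: eq_bigr => i _ /=; rewrite !mulrA.
Qed.

(** By [biorthogonal_profile] the products [a 0 i * b 0 i] vanish
    together or not at all. *)
Lemma biorthogonal_degenerate a b : biorthogonal a b -> ~~ generic_pair a b ->
  forall i, a 0 i * b 0 i = 0.
Proof.
have [kap [kap0 kapP]] := biorthogonal_profile.
move=> ab; rewrite /generic_pair ab andbT negb_forall => /existsP[j].
rewrite negbK => /eqP abj i; have [k kP] := kapP _ _ ab.
have k0 : k = 0.
  have := kP j; rewrite abj mulr0 => /esym/eqP.
  by rewrite mulf_eq0 (negbTE (kap0 j)) orbF => /eqP.
have := kP i; rewrite k0 mul0r => /eqP.
by rewrite mulf_eq0 (gt_eqF (g_gt0 i)) => /eqP.
Qed.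

(** Both [b] and [b'] are proportional to the vector with entries
    [kap i / (g i * a 0 i)]. *)
Lemma generic_pair_direction a b b' : generic_pair a b -> generic_pair a b' ->
  exists k, b' = k *: b.
Proof.
have [kap [kap0 kapP]] := biorthogonal_profile.
move=> /andP[/forallP ne ab] /andP[_ ab'].
have [k kP] := kapP _ _ ab; have [k' kP'] := kapP _ _ ab'.
have a0 i : a 0 i != 0 by apply: contraNneq (ne i) => ->; rewrite mul0r.
have b0 i : b 0 i != 0 by apply: contraNneq (ne i) => ->; rewrite mulr0.
have k0 : k != 0.
  have gab : g 0 * (a 0 0 * b 0 0) != 0 by rewrite mulf_neq0 ?ne ?gt_eqF.
  by apply: contraNneq gab => k0; rewrite kP k0 mul0r.
exists (k' / k); apply/rowP => i; rewrite mxE.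
have gi : g i != 0 by rewrite gt_eqF.
apply: (mulfI (mulf_neq0 gi (a0 i))); rewrite -mulrA kP'.
rewrite -[g i * _ * _]mulrA [a 0 i * (_ * _)]mulrCA [g i * (_ * _)]mulrCA kP.
by field.
Qed.

Lemma diag_form_gt0 a : a != 0 -> 0 < diag_form g a a.
Proof.
move=> a0; have ge0 i : 0 <= g i * (a 0 i * a 0 i).
  by rewrite mulr_ge0 ?(ltW (g_gt0 i)) // -expr2 sqr_ge0.
rewrite lt_neqAle sumr_ge0 // andbT eq_sym; apply: contraNneq a0 => /eqP.
rewrite psumr_eq0 // => /allP h; apply/eqP/rowP => i; rewrite mxE.
have := h i (mem_index_enum _); rewrite /= !mulf_eq0 (gt_eqF (g_gt0 i)) /=.
by rewrite orbb => /eqP.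
Qed.

(** If the vertex of a corner moves along its first leg [a] while the
    ends of both legs stay fixed, the legs become [(1 - k) *: a] and [b] instead
    of [a] and [b + k *: a].  Orthogonality in both positions gives
    k (a, a) = 0, and the form is definite. *)
Lemma generic_pair_inj a b k : generic_pair ((1 - k) *: a) b ->
  generic_pair a (b + k *: a) -> k = 0.
Proof.
move=> /andP[/forallP/(_ 0) ne /andP[/eqP o1 _]] /andP[_ /andP[/eqP o2 _]].
have k1 : 1 - k != 0 by apply: contraNneq ne => ->; rewrite scale0r mxE mul0r.
have a0 : a != 0 by apply: contraNneq ne => ->; rewrite scaler0 mxE mul0r.
have o1' : diag_form g a b = 0.
  apply: (mulfI k1); rewrite mulr0 -[RHS]o1 /diag_form mulr_sumr.
  by apply: eq_bigr => i _; rewrite mxE; ring.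
have : diag_form g a b + k * diag_form g a a = 0.
  rewrite -[RHS]o2 /diag_form mulr_sumr -big_split.
  by apply: eq_bigr => i _ /=; rewrite !mxE; ring.
move/eqP; rewrite o1' add0r mulf_eq0 (gt_eqF (diag_form_gt0 a0)) orbF.
by move/eqP.
Qed.

Variables (T : finType) (v : T -> 'rV[R]_3).
Hypothesis vI : injective v.

Definition parallelograms : {set T * T * (T * T)} :=
  [set q | (v q.1.1 + v q.1.2 == v q.2.1 + v q.2.2) &&
     biorthogonal (v q.2.1 - v q.1.1) (v q.2.2 - v q.1.1)].

Lemma generic_corners_le (J : nat) : (#|T| <= 2 ^ J)%N -> (0 < J)%N ->
  (#|[set q : T * T * T | generic_pair (v q.1.2 - v q.1.1) (v q.2 - v q.1.1)]| <=
     2 * (J.+1 * (2048 * J ^ 3 * #|T| ^ 2)))%N.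
Proof.
move=> cT J0; have [s [t [pxI proj]]] := generic_projection vI.
pose px x := moment_form s (v x); pose py x := moment_form t (v x).
have ne x y z : generic_pair (v y - v x) (v z - v x) -> x != y.
  move=> /andP[/forallP/(_ 0) ne _]; apply: contraNneq ne => ->.
  by rewrite subrr mxE mul0r.
apply: (@corners_le R T px py pxI (fun x y z => generic_pair (v y - v x) (v z - v x))) => //.
- by move=> x y z; apply: generic_pairC.
- move=> x y z z' h h'; have [k kP] := generic_pair_direction h h'.
  rewrite inE -!moment_formB kP !moment_formZ; apply/eqP; ring.
move=> x x' y z h h' lE; have := line_through_l px py x y; rewrite lE.
move=> /(proj _ _ _ (ne _ _ _ h'))[k kP].
have k0 : k = 0.
  apply: (@generic_pair_inj (v y - v x') (v z - v x)).
    by rewrite scalerBl scale1r -kP opprB addrA subrK.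
  by rewrite -kP addrA subrK.
by apply: vI; apply/eqP; rewrite -subr_eq0 kP k0 scale0r.
Qed.

(** A parallelogram with a generic corner is determined by this corner.
    For the others all products [a 0 i * b 0 i] of the sides vanish: where
    [a 0 i] vanishes [y] has the coordinate of [x], elsewhere [b 0 i] vanishes
    and [y] has the coordinate of [w].  So [x], [w] and one of eight masks
    determine such a parallelogram. *)
Theorem parallelograms_le (J : nat) : (#|T| <= 2 ^ J)%N -> (0 < J)%N ->
  (#|parallelograms| <= 4104 * J.+1 ^ 4 * #|T| ^ 2)%N.
Proof.
move=> cT J0.
pose gen (q : T * T * (T * T)) := generic_pair (v q.2.1 - v q.1.1) (v q.2.2 - v q.1.1).
pose G := [set q in parallelograms | gen q].
pose D := [set q in parallelograms | ~~ gen q].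
have cover : (#|parallelograms| <= #|G| + #|D|)%N.
  apply: leq_trans (leq_card_setU _ _); apply/subset_leq_card/subsetP => q qP.
  by rewrite in_setU [q \in G]inE [q \in D]inE qP; case: (gen q).
have cG : (#|G| <= 2 * (J.+1 * (2048 * J ^ 3 * #|T| ^ 2)))%N.
  apply: leq_trans (generic_corners_le cT J0).
  pose f (q : T * T * (T * T)) := (q.1.1, q.2.1, q.2.2).
  have fI : {in G &, injective f}.
    move=> [[x w] [y z]] [[x' w'] [y' z']]; rewrite !inE /=.
    move=> /andP[/andP[/eqP e _] _] /andP[/andP[/eqP e' _] _] [ex ey ez].
    subst x' y' z'; congr (_, _, _); apply: vI; apply: (@addrI _ (v x)).
    by rewrite e e'.
  rewrite -(card_in_imset fI); apply/subset_leq_card/subsetP => r /imsetP[q].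
  by rewrite [q \in G]inE => /andP[_ gq] ->; rewrite inE.
have cD : (#|D| <= 8 * #|T| ^ 2)%N.
  pose f (q : T * T * (T * T)) :=
    (q.1.1, q.1.2, [set i | (v q.2.1 - v q.1.1) 0 i == 0]).
  have yE q i : q \in D -> v q.2.1 0 i =
      if i \in (f q).2 then v q.1.1 0 i else v q.1.2 0 i.
    rewrite !inE => /andP[/andP[/eqP sumE bi] ng].
    have ab := biorthogonal_degenerate bi ng i.
    rewrite /f /= ?inE; case: eqP => [|/eqP ay].
      by rewrite !mxE => /eqP; rewrite subr_eq0 => /eqP.
    move/eqP: ab; rewrite mulf_eq0 (negbTE ay) /= !mxE subr_eq0 => /eqP bz.
    have := congr1 (fun u : 'rV[R]_3 => u 0 i) sumE; rewrite !mxE bz addrC.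
    by move/addIr.
  have fI : {in D &, injective f}.
    move=> q q' qD q'D e; have ey : v q.2.1 = v q'.2.1.
      by apply/rowP => i; rewrite !yE // e; case: e => -> ->.
    move: qD q'D e ey; case: q q' => [[x w] [y z]] [[x' w'] [y' z']].
    rewrite !inE /=.
    move=> /andP[/andP[/eqP e _] _] /andP[/andP[/eqP e' _] _] [ex ew _] /vI ey.
    subst x' y' w'; congr (_, _, (_, _)); apply: vI; apply: (@addrI _ (v y)).
    by rewrite -e -e'.
  rewrite -(card_in_imset fI); apply: leq_trans (max_card _) _.
  have c8 : #|{: {set 'I_3}}| = 8%N.
    by rewrite -cardsT -powersetT card_powerset cardsT card_ord.
  by rewrite !card_prod c8 mulnC -mulnn.
apply: (leq_trans cover); apply: (leq_trans (leq_add cG cD)).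
set N2 := (#|T| ^ 2)%N.
have -> : (2 * (J.+1 * (2048 * J ^ 3 * N2)) + 8 * N2 = (4096 * (J.+1 * J ^ 3) + 8) * N2)%N by ring.
rewrite leq_mul2r; apply/orP; right.
have h1 : (J.+1 * J ^ 3 <= J.+1 ^ 4)%N by rewrite [leqRHS]expnS leq_mul // leq_exp2r.
have h2 : (0 < J.+1 ^ 4)%N by rewrite expn_gt0.
lia.
Qed.

End Parallelograms.

(** * Convolutions and additive energies *)

Section Bilinear.
Variable R : realFieldType.

Lemma sqr_sum_le (I : finType) (a : I -> R) :
  (\sum_i a i) ^+ 2 <= #|I|%:R * \sum_i a i ^+ 2.
Proof.
rewrite expr2 big_distrlr /=.
apply: (@le_trans _ _ (\sum_i \sum_j (a i ^+ 2 / 2 + a j ^+ 2 / 2))).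
  apply: ler_sum => i _; apply: ler_sum => j _.
  by have := sqr_ge0 (a i - a j); nra.
have -> : \sum_i \sum_j (a i ^+ 2 / 2 + a j ^+ 2 / 2) =
    \sum_i (#|I|%:R * (a i ^+ 2 / 2) + (\sum_j a j ^+ 2) / 2).
  by apply: eq_bigr => i _; rewrite big_split /= sumr_const mulr_natl -mulr_suml.
rewrite big_split /= sumr_const -mulr_sumr -mulr_suml -[_ *+ _]mulr_natl.
by rewrite le_eqVlt; apply/orP; left; apply/eqP; field.
Qed.

Variable V : zmodType.

(** Summing over the common value [d] replaces the condition
    [phi i == psi k] by two separate ones; it is used for sums as well as for
    differences. *)
Lemma sum_matching (I K : finType) (phi : I -> V) (psi : K -> V) (F : I -> R)
    (G : K -> R) (D : seq V) : uniq D -> (forall i, phi i \in D) ->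
  \sum_(d <- D) (\sum_i (phi i == d)%:R * F i) * (\sum_k (psi k == d)%:R * G k) =
  \sum_i \sum_k (phi i == psi k)%:R * (F i * G k).
Proof.
move=> uD phiD; under eq_bigr do rewrite big_distrlr /=.
rewrite exchange_big; apply: eq_bigr => i _ /=.
rewrite exchange_big; apply: eq_bigr => k _ /=.
rewrite (bigD1_seq (phi i)) //= big1 => [|d dn]; last by rewrite eq_sym (negbTE dn) !mul0r.
by rewrite eqxx mul1r addr0 eq_sym mulrCA.
Qed.

Definition sum_density (T T' : finType) (h : T -> V) (h' : T' -> V)
    (F : T -> R) (G : T' -> R) (z : V) : R :=
  \sum_x \sum_y (h x + h' y == z)%:R * (F x * G y).

Definition indic (T : finType) (A : {set T}) (x : T) : R := (x \in A)%:R.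

Definition energy (T : finType) (h : T -> V) (A : {set T}) : nat :=
  #|[set q : T * T * (T * T) | [&& q.1.1 \in A, q.1.2 \in A, q.2.1 \in A, q.2.2 \in A &
      h q.1.1 + h q.1.2 == h q.2.1 + h q.2.2]]|.

Definition diff_density (T : finType) (h : T -> V) (A : {set T}) (d : V) : R :=
  \sum_(p : T * T) (h p.1 - h p.2 == d)%:R * (indic A p.1 * indic A p.2).

Lemma energyE (T : finType) (h : T -> V) (A : {set T}) :
  (energy h A)%:R = \sum_(p : T * T) \sum_(q : T * T) (h p.1 - h p.2 == h q.1 - h q.2)%:R *
    (indic A p.1 * indic A p.2 * (indic A q.1 * indic A q.2)).
Proof.
rewrite /energy -sum1_card natr_sum pair_bigA /= big_mkcond /=.
(* a + d = c + b is the same equation as a - b = c - d. *)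
rewrite (reindex_inj
  (h := fun q : T * T * (T * T) => (q.1.1, q.2.2, (q.2.1, q.1.2)))) /=; last first.
  by move=> [[a b] [c d]] [[a' b'] [c' d']] [-> -> -> ->].
apply: eq_bigr => -[[a b] [c d]] _ /=; rewrite inE /= /indic.
have -> : (h a + h d == h c + h b) = (h a - h b == h c - h d).
  rewrite -subr_eq0 -[RHS]subr_eq0; congr (_ == 0).
  by rewrite !opprD !opprK addrACA [RHS]addrACA [- h b + _]addrC.
by case: (a \in A); case: (b \in A); case: (c \in A); case: (d \in A);
  case: (_ == _); rewrite /= ?(mulr0, mul0r, mulr1).
Qed.

Section MixedEnergy.
Variables (T T' : finType) (h : T -> V) (h' : T' -> V).

Lemma sum_density_sqr (F : T -> R) (G : T' -> R) (Z : seq V) :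
  uniq Z -> (forall x y, h x + h' y \in Z) ->
  \sum_(z <- Z) sum_density h h' F G z ^+ 2 =
  \sum_(p : T * T) \sum_(q : T' * T') (h p.1 - h p.2 == h' q.1 - h' q.2)%:R *
    (F p.1 * F p.2 * (G q.1 * G q.2)).
Proof.
move=> uZ hZ.
transitivity (\sum_(p : T * T') \sum_(q : T * T') (h p.1 + h' p.2 == h q.1 + h' q.2)%:R *
   ((F p.1 * G p.2) * (F q.1 * G q.2))).
  rewrite -(sum_matching (fun q : T * T' => h q.1 + h' q.2) _ _ uZ); last by move=> p; apply: hZ.
  apply: eq_bigr => z _; rewrite expr2 /sum_density.
  by rewrite (pair_bigA _ (fun x y => (h x + h' y == z)%:R * (F x * G y))).
rewrite !pair_bigA /=.
(* x + y = x' + y' is the same equation as x - x' = y' - y. *)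
pose f (q : T * T * (T' * T')) := ((q.1.1, q.2.2), (q.1.2, q.2.1)).
rewrite (reindex f) /=; last first.
  apply: onW_bij; exists (fun q => ((q.1.1, q.2.1), (q.2.2, q.1.2))).
    by move=> [[a b] [c d]].
  by move=> [[a b] [c d]].
apply: eq_bigr => -[[a b] [c d]] _ /=; congr (_%:R * _); last by ring.
by congr nat_of_bool; rewrite -subr_eq0 -[RHS]subr_eq0; congr (_ == 0);
  rewrite !opprD !opprK addrACA [- h' c + _]addrC.
Qed.


Lemma energy_diff_density (U : finType) (k : U -> V) (A : {set U}) (D : seq V) :
  uniq D -> (forall x y, k x - k y \in D) ->
  \sum_(d <- D) diff_density k A d ^+ 2 = (energy k A)%:R.
Proof.
move=> uD kD; rewrite energyE -(sum_matching (fun q : U * U => k q.1 - k q.2) _ _ uD).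
  by apply: eq_bigr => d _; rewrite expr2.
by move=> p; apply: kD.
Qed.

(** Written with differences, the mixed count is the sum over [d] of
    [diff_density h A d * diff_density h' B d]; after weighting the factors by
    [#|B|] and [#|A|], the inequality 2 x y <= x^2 + y^2 separates the two
    energies. *)
Lemma sum_density_indic_le (K : R) (A : {set T}) (B : {set T'}) (Z : seq V) :
  (energy h A)%:R <= K * #|A|%:R ^+ 2 -> (energy h' B)%:R <= K * #|B|%:R ^+ 2 ->
  uniq Z -> (forall x y, h x + h' y \in Z) ->
  \sum_(z <- Z) sum_density h h' (indic A) (indic B) z ^+ 2 <= K * (#|A|%:R * #|B|%:R).
Proof.
move=> EA EB uZ hZ.
have indic0 (U : finType) (x : U) : indic set0 x = 0 by rewrite /indic inE.
have [->|/set0Pn[a aA]] := eqVneq A set0.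
  rewrite big1 ?cards0 ?mul0r ?mulr0 // => z _; rewrite /sum_density.
  by rewrite big1 ?expr0n // => x _; rewrite big1 // => y _; rewrite indic0 mul0r mulr0.
have [->|/set0Pn[b bB]] := eqVneq B set0.
  rewrite big1 ?cards0 ?mulr0 // => z _; rewrite /sum_density.
  by rewrite big1 ?expr0n // => x _; rewrite big1 // => y _; rewrite indic0 !mulr0.
pose D := undup ([seq h p.1 - h p.2 | p <- enum {: T * T}] ++
                 [seq h' p.1 - h' p.2 | p <- enum {: T' * T'}]).
have hD x y : h x - h y \in D.
  rewrite mem_undup mem_cat; apply/orP; left; apply/mapP.
  by exists (x, y); rewrite ?mem_enum.
have h'D x y : h' x - h' y \in D.
  rewrite mem_undup mem_cat; apply/orP; right; apply/mapP.
  by exists (x, y); rewrite ?mem_enum.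
have uD : uniq D := undup_uniq _.
rewrite sum_density_sqr // -(sum_matching (fun q : T' * T' => h' q.1 - h' q.2) _ _ uD); last first.
  by move=> p; apply: hD.
set S := \sum_(d <- D) _.
have A0 : 0 < #|A|%:R :> R by rewrite ltr0n card_gt0; apply/set0Pn; exists a.
have B0 : 0 < #|B|%:R :> R by rewrite ltr0n card_gt0; apply/set0Pn; exists b.
have amgm : 2 * (#|A|%:R * #|B|%:R) * S <=
    #|B|%:R ^+ 2 * (energy h A)%:R + #|A|%:R ^+ 2 * (energy h' B)%:R.
  rewrite -(energy_diff_density A uD hD) -(energy_diff_density B uD h'D).
  rewrite !mulr_sumr -big_split; apply: ler_sum => d _ /=.
  rewrite -/(diff_density h A d) -/(diff_density h' B d).
  have := sqr_ge0 (#|B|%:R * diff_density h A d - #|A|%:R * diff_density h' B d).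
  set x := diff_density h A d; set y := diff_density h' B d.
  set p := #|A|%:R; set q := #|B|%:R; clear; lra.
have AB0 : 0 < #|A|%:R * #|B|%:R :> R by rewrite mulr_gt0.
rewrite -(ler_pM2l (mulr_gt0 (ltr0n R 2) AB0)); apply: (le_trans amgm).
have h1 := ler_wpM2l (sqr_ge0 #|B|%:R) EA.
have h2 := ler_wpM2l (sqr_ge0 #|A|%:R) EB.
apply: (le_trans (lerD h1 h2)); rewrite le_eqVlt; apply/orP; left; apply/eqP; ring.
Qed.

End MixedEnergy.

Lemma dyadic_level (M x : R) (J : nat) : 0 <= M -> 0 <= x <= M ->
  exists j : 'I_J.+1, x <= M / 2 ^+ j /\ (val j = J \/ M / 2 ^+ j <= 2 * x).
Proof.
move=> M0 /andP[x0 xM]; elim: J => [|J [j [xj jJ]]].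
  by exists ord0; rewrite expr0 divr1; split=> //; left.
have half n : M / 2 ^+ n = 2 * (M / 2 ^+ n.+1).
  by rewrite exprS invfM [M * (_ * _)]mulrCA mulVKf // pnatr_eq0.
case: jJ => [jJ|jx]; last first.
  by exists (widen_ord (leqnSn _) j); split=> //; right.
have [le|lt] := leP x (M / 2 ^+ J.+1).
  by exists ord_max; split=> //; left.
exists (widen_ord (leqnSn _) j); split=> //; right => /=.
by rewrite jJ half ler_pM2l // ltW.
Qed.

(** [M] is the ell^2 norm of [F].  Values above [M / 2 ^+ J] are rounded
    up by a factor of at most 2; the others are replaced by [M / 2 ^+ J], which
    contributes at most [#|T|%:R * (M / 2 ^+ J) ^+ 2 <= M ^+ 2]. *)
Lemma dyadic_majorant (T : finType) (F : T -> R) (M : R) (J : nat) :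
  (forall x, 0 <= F x) -> 0 <= M -> M ^+ 2 = \sum_x F x ^+ 2 -> (#|T| <= 2 ^ J)%N ->
  exists (lev : T -> 'I_J.+1) (u : 'I_J.+1 -> R), [/\ forall j, 0 <= u j,
    forall x, F x <= u (lev x) & \sum_x u (lev x) ^+ 2 <= 5 * \sum_x F x ^+ 2].
Proof.
move=> F0 M0 M2 cT.
have FM x : 0 <= F x <= M.
  rewrite F0 -(@ler_pXn2r _ 2) ?nnegrE //= M2 (bigD1 x) //= lerDl.
  by apply: sumr_ge0 => y _; apply: sqr_ge0.
have [lev levP] := fin_all_exists (fun x => dyadic_level J M0 (FM x)).
exists lev, (fun j => M / 2 ^+ j); split=> [j|x|].
- by rewrite divr_ge0 // exprn_ge0.
- by case: (levP x).
have sq x : (M / 2 ^+ lev x) ^+ 2 <= 4 * F x ^+ 2 + M ^+ 2 / 2 ^+ J.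
  have Mge0 : 0 <= M / 2 ^+ lev x by rewrite divr_ge0 // exprn_ge0.
  have [_ [levJ|le2]] := levP x.
    apply: ler_wpDl; first by rewrite mulr_ge0 ?sqr_ge0.
    rewrite levJ expr_div_n ler_wpM2l ?sqr_ge0 // lef_pV2 ?posrE ?exprn_gt0 //.
    by rewrite -exprM ler_eXn2l ?ltr1n // muln2 -addnn leq_addr.
  apply: ler_wpDr; first by rewrite divr_ge0 ?sqr_ge0 ?exprn_ge0.
  have -> : 4 * F x ^+ 2 = (2 * F x) ^+ 2 by ring.
  by rewrite ler_pXn2r ?nnegrE // mulr_ge0 // F0.
apply: (le_trans (ler_sum _ (fun x _ => sq x))).
rewrite big_split /= -mulr_sumr sumr_const -mulr_natl.
have : #|T|%:R * (M ^+ 2 / 2 ^+ J) <= M ^+ 2.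
  rewrite mulrA ler_pdivrMr ?exprn_gt0 // mulrC ler_wpM2l ?sqr_ge0 //.
  by rewrite -natrX ler_nat.
rewrite M2; lra.
Qed.

(** Replace [F] and [G] by their dyadic majorants, apply
    [sum_density_indic_le] to each pair of levels and the Cauchy-Schwarz
    inequality to the sum over the [J.+1 ^ 2] pairs of levels. *)
Theorem sum_density_le (T T' : finType) (h : T -> V) (h' : T' -> V) (K : R) (J : nat)
    (F : T -> R) (G : T' -> R) (M M' : R) (Z : seq V) :
  (forall A : {set T}, (energy h A)%:R <= K * #|A|%:R ^+ 2) ->
  (forall B : {set T'}, (energy h' B)%:R <= K * #|B|%:R ^+ 2) ->
  (#|T| <= 2 ^ J)%N -> (#|T'| <= 2 ^ J)%N -> 0 <= K ->
  (forall x, 0 <= F x) -> (forall y, 0 <= G y) ->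
  0 <= M -> M ^+ 2 = \sum_x F x ^+ 2 -> 0 <= M' -> M' ^+ 2 = \sum_y G y ^+ 2 ->
  uniq Z -> (forall x y, h x + h' y \in Z) ->
  \sum_(z <- Z) sum_density h h' F G z ^+ 2 <=
    25 * J.+1%:R ^+ 2 * K * (M ^+ 2 * M' ^+ 2).
Proof.
move=> EA EB cT cT' K0 F0 G0 M0 M2 M'0 M'2 uZ hZ.
have [a [u [u0 Fu usum]]] := dyadic_majorant F0 M0 M2 cT.
have [b [w [w0 Gw wsum]]] := dyadic_majorant G0 M'0 M'2 cT'.
pose A j := [set x | a x == j]; pose B k := [set y | b y == k].
have expand (U : finType) (lev : U -> 'I_J.+1) (c : 'I_J.+1 -> R) x :
    c (lev x) = \sum_j c j * indic [set y | lev y == j] x.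
  rewrite (bigD1 (lev x)) //= /indic inE eqxx mulr1 big1 ?addr0 // => j jx.
  by rewrite inE eq_sym (negbTE jx) mulr0.
have card_lev (U : finType) (lev : U -> 'I_J.+1) (c : 'I_J.+1 -> R) :
    \sum_x c (lev x) = \sum_j c j * #|[set y | lev y == j]|%:R.
  under eq_bigr do rewrite expand.
  rewrite exchange_big /=; apply: eq_bigr => j _; rewrite -mulr_sumr; congr (_ * _).
  rewrite -sum1_card natr_sum [RHS]big_mkcond; apply: eq_bigr => y _.
  by rewrite /indic; case: (_ \in _).
pose term z (jk : 'I_J.+1 * 'I_J.+1) :=
  u jk.1 * w jk.2 * sum_density h h' (indic (A jk.1)) (indic (B jk.2)) z.
have point z : sum_density h h' F G z ^+ 2 <= J.+1%:R ^+ 2 * \sum_jk term z jk ^+ 2.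
  have -> : J.+1%:R ^+ 2 = #|{: 'I_J.+1 * 'I_J.+1}|%:R :> R.
    by rewrite card_prod card_ord -natrX mulnn.
  apply: le_trans (sqr_sum_le _).
  have -> : \sum_jk term z jk = sum_density h h' (fun x => u (a x)) (fun y => w (b y)) z.
    rewrite /sum_density; transitivity (\sum_x \sum_y \sum_(jk : 'I_J.+1 * 'I_J.+1)
      (h x + h' y == z)%:R * ((u jk.1 * indic (A jk.1) x) * (w jk.2 * indic (B jk.2) y))).
      rewrite /term; under eq_bigr do rewrite mulr_sumr.
      rewrite exchange_big; apply: eq_bigr => x _ /=.
      under eq_bigr do rewrite mulr_sumr.
      rewrite exchange_big; apply: eq_bigr => y _ /=; apply: eq_bigr => jk _; ring.
    apply: eq_bigr => x _; apply: eq_bigr => y _; rewrite -mulr_sumr; congr (_ * _).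
    rewrite (expand _ a u x) (expand _ b w y) big_distrlr /=.
    by rewrite pair_bigA.
  rewrite ler_pXn2r ?nnegrE //; last 2 first.
  - by do 2!(apply: sumr_ge0 => ? _); rewrite !mulr_ge0.
  - by do 2!(apply: sumr_ge0 => ? _); rewrite !mulr_ge0.
  do 2!(apply: ler_sum => ? _); apply: ler_wpM2l => //.
  by apply: ler_pM.
apply: (le_trans (ler_sum _ (fun z _ => point z))).
rewrite -mulr_sumr exchange_big /=.
have level jk : \sum_(z <- Z) term z jk ^+ 2 <=
    K * ((u jk.1 ^+ 2 * #|A jk.1|%:R) * (w jk.2 ^+ 2 * #|B jk.2|%:R)).
  rewrite /term; under eq_bigr do rewrite exprMn.
  rewrite -mulr_sumr.
  have := sum_density_indic_le (EA (A jk.1)) (EB (B jk.2)) uZ hZ.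
  move=> /(ler_wpM2l (sqr_ge0 (u jk.1 * w jk.2))) /le_trans; apply.
  by rewrite le_eqVlt; apply/orP; left; apply/eqP; ring.
have -> : 25 * J.+1%:R ^+ 2 * K * (M ^+ 2 * M' ^+ 2) =
    J.+1%:R ^+ 2 * (K * ((5 * M ^+ 2) * (5 * M' ^+ 2))) by ring.
apply: ler_wpM2l; first exact: sqr_ge0.
apply: (le_trans (ler_sum _ (fun jk _ => level jk))).
rewrite -mulr_sumr ler_wpM2l //.
rewrite -(pair_bigA _ (fun j k => u j ^+ 2 * #|A j|%:R * (w k ^+ 2 * #|B k|%:R))) /=.
rewrite -big_distrlr /= -!(card_lev _ _ (fun j => _ j ^+ 2)).
by rewrite M2 M'2 ler_pM //; apply: sumr_ge0 => ? _; apply: sqr_ge0.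
Qed.

End Bilinear.

(** * Diagonal coordinates and energies on a threefold *)

Section DiagonalCoordinates.
Variable R : realType.

Lemma symmetricmx_tr n (A : 'M[R]_n) : A \is symmetricmx -> A^T = A.
Proof. by move=> /is_hermitianmxP symA; rewrite {2}symA expr0 scale1r map_mx_id. Qed.

Definition bilin n (A : 'M[R]_n) (a b : 'cV[R]_n) : R := (a^T *m A *m b) 0 0.

Lemma bilinC n (A : 'M[R]_n) a b : A^T = A -> bilin A a b = bilin A b a.
Proof.
move=> symA; have -> : bilin A a b = (a^T *m A *m b)^T 0 0 by rewrite mxE.
by rewrite !trmx_mul trmxK symA mulmxA.
Qed.

Lemma bilinDl n (A : 'M[R]_n) a a' b : bilin A (a + a') b = bilin A a b + bilin A a' b.
Proof. by rewrite /bilin linearD /= !mulmxDl mxE. Qed.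

Lemma bilinDr n (A : 'M[R]_n) a b b' : bilin A a (b + b') = bilin A a b + bilin A a b'.
Proof. by rewrite /bilin mulmxDr mxE. Qed.

Lemma bilinNl n (A : 'M[R]_n) a b : bilin A (- a) b = - bilin A a b.
Proof. by rewrite /bilin linearN /= !mulNmx mxE. Qed.

Lemma bilinNr n (A : 'M[R]_n) a b : bilin A a (- b) = - bilin A a b.
Proof. by rewrite /bilin mulmxN mxE. Qed.

Lemma posdefmx_unit n (A : 'M[R]_n) : posdefmx A -> A \in unitmx.
Proof.
move=> [_ pos]; rewrite unitmxE unitfE; apply/negP => /det0P[u u0 uA].
have /pos : u^T != 0 by rewrite trmx_eq0.
by rewrite /quadmx trmxK uA mul0mx mxE ltxx.
Qed.

Lemma diag_formE (g : 'I_3 -> R) a b :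
  diag_form g a^T b^T = bilin (diag_mx (\row_i g i)) a b.
Proof.
rewrite /bilin -mulmxA mul_diag_mx mxE; apply: eq_bigr => i _.
by rewrite !mxE; ring.
Qed.

Lemma bilinM n (K W : 'M[R]_n) a b :
  bilin K (W *m a) (W *m b) = bilin (W^T *m K *m W) a b.
Proof. by rewrite /bilin trmx_mul !mulmxA. Qed.

(** With [B] the inverse square root of [A1], the matrix
    [M = B *m A2 *m B] is symmetric with distinct eigenvalues, so its
    eigenvectors are the rows of a matrix [V] with orthogonal rows, and
    [G = V *m V^T] is diagonal.  The coordinates are [W = V *m invmx B], and the
    weights are the inverses of the diagonal entries of [G]. *)
Theorem simultaneous_diagonalization (A1 A2 : 'M[R]_3) :
  A2 \is symmetricmx -> simple_generalized_spectrum A1 A2 ->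
  exists (W : 'M[R]_3) (g lam : 'I_3 -> R),
    [/\ W \in unitmx, forall i, 0 < g i, injective lam,
      forall a b, bilin A1 a b = diag_form g (W *m a)^T (W *m b)^T &
      forall a b, bilin A2 a b = diag_form (fun i => lam i * g i) (W *m a)^T (W *m b)^T].
Proof.
move=> /symmetricmx_tr symA2 [posA1 [s [s3 us /allP spec]]].
have A1u := posdefmx_unit posA1.
pose lam (i : 'I_3) := s`_i.
have lamI : injective lam.
  by move=> i j /eqP; rewrite nth_uniq ?s3 // => /eqP/val_inj.
move: spec; rewrite /invsqrtmx; case: xgetP => [B _ [posB BB]|_] spec; last first.
  (* The default value 0 of the inverse square root would give a matrix
     whose only eigenvalue is 0. *)
  have lam0 i : lam i = 0.
    have /spec/eigenvalueP[u] : lam i \in s by rewrite mem_nth ?s3.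
    rewrite mul0mx mul0mx mulmx0 => /esym/eqP; rewrite scaler_eq0 => /orP[/eqP//|->//].
  by have /lamI := etrans (lam0 0) (esym (lam0 1)).
have [symB _] := posB; move/symmetricmx_tr in symB.
have Bu := posdefmx_unit posB.
pose M := B *m A2 *m B.
have eigvec i : exists u : 'rV[R]_3, u *m M = lam i *: u /\ u != 0.
  have /spec/eigenvalueP[u uM u0] : lam i \in s by rewrite mem_nth ?s3.
  by exists u.
have [vec vecP] := fin_all_exists eigvec.
pose V := \matrix_i vec i.
pose D := diag_mx (\row_i lam i).
have VM : V *m M = D *m V.
  apply/row_matrixP => i; rewrite row_mul rowK (proj1 (vecP i)).
  by rewrite mul_diag_mx; apply/rowP => j; rewrite !mxE.
have symM : M^T = M by rewrite /M !trmx_mul symB symA2 mulmxA.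
pose G := V *m V^T.
have symG : G^T = G by rewrite /G trmx_mul trmxK.
(* D G = V M V^T is symmetric, and its transpose is G D.  As the entries of D
   are distinct, this makes G diagonal. *)
have DG : D *m G = G *m D.
  have e : V *m M *m V^T = D *m G by rewrite VM mulmxA.
  have <- : (D *m G)^T = G *m D by rewrite trmx_mul symG tr_diag_mx.
  by rewrite -e trmx_mul trmxK [(V *m M)^T]trmx_mul symM mulmxA.
pose gam i := G i i.
have gam_gt0 i : 0 < gam i.
  have -> : gam i = \sum_j vec i 0 j ^+ 2.
    by rewrite /gam mxE; apply: eq_bigr => j _; rewrite !mxE expr2.
  rewrite lt_neqAle sumr_ge0 => [|j _]; last exact: sqr_ge0.
  rewrite andbT eq_sym; apply: contraNneq (proj2 (vecP i)) => /eqP.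
  rewrite psumr_eq0 => [|j _]; last exact: sqr_ge0.
  move=> /allP h; apply/eqP/rowP => j; rewrite mxE.
  by have := h j (mem_index_enum _); rewrite /= sqrf_eq0 => /eqP.
have GE : G = diag_mx (\row_i gam i).
  apply/matrixP => i j; rewrite [RHS]mxE.
  have [<-|ne] := eqVneq i j; first by rewrite [X in X *+ _]mxE.
  rewrite ?(negbTE ne) mulr0n; have := congr1 (fun Z : 'M[R]_3 => Z i j) DG.
  rewrite mul_diag_mx mul_mx_diag [LHS]mxE [RHS]mxE [(\row_k lam k) 0 i]mxE.
  rewrite [(\row_k lam k) 0 j]mxE mulrC => /eqP.
  by rewrite -subr_eq0 -mulrBr mulf_eq0 subr_eq0 (inj_eq lamI) (negbTE ne) orbF => /eqP.
pose H := diag_mx (\row_i (gam i)^-1).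
have GH : G *m H = 1%:M.
  rewrite GE /H mulmx_diag; apply/matrixP => i j; rewrite !mxE.
  by rewrite divff // gt_eqF.
have GH0 : V *m (V^T *m H) = 1%:M by rewrite mulmxA.
have HV : V^T *m H *m V = 1%:M.
  by apply: mulmx1C; rewrite mulmxA.
have iBB : invmx B *m invmx B = A1.
  have : B *m B *m A1 = 1%:M by rewrite BB mulVmx.
  move=> /(congr1 (fun X => invmx B *m (invmx B *m X))).
  by rewrite mulmx1 -mulmxA !mulKmx.
have symiB : (invmx B)^T = invmx B by rewrite trmx_inv symB.
exists (V *m invmx B), (fun i => (gam i)^-1), lam; split=> //.
- by rewrite unitmx_mul unitmx_inv Bu andbT; case: (mulmx1_unit GH0).
- by move=> i; rewrite invr_gt0.
- move=> a b; rewrite diag_formE bilinM -/H trmx_mul symiB.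
  by rewrite -mulmxA -!mulmxA !(mulmxA V^T) (mulmxA (V^T *m H)) HV mul1mx iBB.
move=> a b; rewrite diag_formE bilinM trmx_mul symiB.
have -> : diag_mx (\row_i (lam i * (gam i)^-1)) = H *m D.
  by rewrite mulmx_diag; congr diag_mx; apply/rowP => i; rewrite !mxE mulrC.
have -> : invmx B *m V^T *m (H *m D) *m (V *m invmx B)
    = invmx B *m (V^T *m H *m V) *m M *m invmx B.
  by rewrite -!mulmxA (mulmxA D) -VM !mulmxA.
by rewrite HV mulmx1 /M !mulmxA mulVmx // mul1mx -mulmxA mulmxV // mulmx1.
Qed.

End DiagonalCoordinates.

Section ThreefoldEnergy.
Variable R : realType.

Definition additive_quadruples (V : zmodType) (T : finType) (h : T -> V) :
    {set T * T * (T * T)} :=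
  [set q | h q.1.1 + h q.1.2 == h q.2.1 + h q.2.2].

(** Writing [w = x + a + b], [y = x + a], [z = x + b], the two sides of
    the quadratic identity differ by twice the bilinear form at [a] and [b]. *)
Lemma parallelogram_orthogonal n (A : 'M[R]_n) (x w y z : 'cV[R]_n) : A^T = A ->
  x + w = y + z -> bilin A x x + bilin A w w = bilin A y y + bilin A z z ->
  bilin A (y - x) (z - x) = 0.
Proof.
move=> symA sumE; have -> : w = y + z - x by rewrite -sumE addrAC subrr add0r.
rewrite !(bilinDl, bilinDr, bilinNl, bilinNr).
rewrite (bilinC y x symA) (bilinC z x symA) (bilinC z y symA) => e.
lra.
Qed.

Theorem threefold_quadruples_le (S : set 'cV[R]_5) (T : finType) (h : T -> 'cV[R]_5)
    (J : nat) :
  quadratic_threefold S -> injective h -> (forall x, S (h x)) ->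
  (#|T| <= 2 ^ J)%N -> (0 < J)%N ->
  (#|additive_quadruples h| <= 4104 * J.+1 ^ 4 * #|T| ^ 2)%N.
Proof.
move=> [A1 [A2 [symA1 symA2 spec ->]]] hI hS cT J0.
have [W [g [lam [Wu g_gt0 lamI A1E A2E]]]] := simultaneous_diagonalization symA2 spec.
move/symmetricmx_tr in symA1; move/symmetricmx_tr in symA2.
have hSu x : exists u : 'cV[R]_3,
    h x = (col_mx u (col_mx (quadmx A1 u) (quadmx A2 u)) : 'cV[R]_(3 + (1 + 1))).
  by have [u _ <-] := hS x; exists u.
have [u uE] := fin_all_exists hSu.
pose v x : 'rV[R]_3 := (W *m u x)^T.
have vI : injective v.
  move=> x y /trmx_inj e; apply: hI; rewrite !uE.
  by have -> : u x = u y by rewrite -(mulKmx Wu (u x)) e mulKmx.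
apply: leq_trans (parallelograms_le g_gt0 lamI vI cT J0).
apply/subset_leq_card/subsetP => -[[x w] [y z]]; rewrite !inE /= => /eqP sumE.
have : (col_mx (u x) (col_mx (quadmx A1 (u x)) (quadmx A2 (u x))) +
   col_mx (u w) (col_mx (quadmx A1 (u w)) (quadmx A2 (u w))) =
   col_mx (u y) (col_mx (quadmx A1 (u y)) (quadmx A2 (u y))) +
   col_mx (u z) (col_mx (quadmx A1 (u z)) (quadmx A2 (u z))) :> 'cV[R]_(3 + (1 + 1))).
  by rewrite -!uE.
rewrite !add_col_mx => /eq_col_mx[uS /eq_col_mx[Q1 Q2]].
have bi (A : 'M[R]_3) : A^T = A ->
    quadmx A (u x) + quadmx A (u w) = quadmx A (u y) + quadmx A (u z) ->
    bilin A (u y - u x) (u z - u x) = 0.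
  move=> symA /(congr1 (fun X : 'M[R]_1 => X 0 0)) e.
  have addE (P Q : 'M[R]_1) : (P + Q) 0 0 = P 0 0 + Q 0 0 by rewrite mxE.
  by rewrite !addE in e; apply: (parallelogram_orthogonal symA uS).
have vD a b : (W *m a)^T + (W *m b)^T = (W *m (a + b))^T by rewrite mulmxDr linearD.
have vB a b : (W *m a)^T - (W *m b)^T = (W *m (a - b))^T by rewrite mulmxBr linearB.
by rewrite /biorthogonal /v !vD uS !vB -A1E -A2E !bi ?eqxx.
Qed.

Theorem threefold_energy_le (S : set 'cV[R]_5) (T : finType) (h : T -> 'cV[R]_5)
    (J : nat) :
  quadratic_threefold S -> injective h -> (forall x, S (h x)) ->
  (#|T| <= 2 ^ J)%N -> (0 < J)%N ->
  forall A : {set T}, (energy h A <= 4104 * J.+1 ^ 4 * #|A| ^ 2)%N.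
Proof.
move=> qS hI hS cT J0 A; pose sT := {x : T | x \in A}.
have csT : #|{: sT}| = #|A| by rewrite card_sig.
pose k (x : sT) := h (val x).
have kI : injective k by move=> x y /hI/val_inj.
have := @threefold_quadruples_le S sT k J qS kI (fun x => hS (val x)).
rewrite csT => /(_ (leq_trans (max_card _) cT) J0); apply: leq_trans.
pose f (q : sT * sT * (sT * sT)) := ((val q.1.1, val q.1.2), (val q.2.1, val q.2.2)).
have fI : injective f.
  move=> [[a b] [c d]] [[a' b'] [c' d']] [/val_inj e1 /val_inj e2 /val_inj e3 /val_inj e4].
  by rewrite e1 e2 e3 e4.
rewrite /energy -(card_imset _ fI).
apply/subset_leq_card/subsetP => -[[a b] [c d]].
rewrite inE /= => /and5P[aA bA cA dA e]; apply/imsetP.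
pose sub x (xA : x \in A) : sT := exist _ x xA.
by exists ((sub a aA, sub b bA), (sub c cA, sub d dA)); rewrite ?inE.
Qed.

End ThreefoldEnergy.

(** * Norms and convolutions of functions with finite support *)

Local Open Scope classical_set_scope.

Local Notation normc := ComplexField.Normc.normc.

Section Norms.
Variable R : realType.

Lemma normc_ge0 (z : R[i]) : 0 <= normc z.
Proof. by case: z => x y; apply: sqrtr_ge0. Qed.

Lemma normc_sum (I : Type) (r : seq I) (F : I -> R[i]) :
  normc (\sum_(i <- r) F i) <= \sum_(i <- r) normc (F i).
Proof.
elim: r => [|i r IH]; first by rewrite !big_nil ComplexField.Normc.normc0.
by rewrite !big_cons (le_trans (le_normcD _ _)) // lerD2l.
Qed.

Lemma lpnorm_seq (T : choiceType) (p : R) (f : T -> R[i]) (r : seq T) :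
  p != 0 -> uniq r -> (forall x, x \notin r -> f x = 0) ->
  lpnorm p f = ((\sum_(x <- r) normc (f x) `^ p) `^ p^-1)%:E.
Proof.
move=> p0 ur supp; rewrite /lpnorm.
have -> : (\esum_(x in [set: T]) (normc (f x) `^ p)%:E =
    \esum_(x in [set` r]) (normc (f x) `^ p)%:E)%E.
  rewrite [RHS]esum_mkcond; apply: eq_esum => x _.
  case: ifPn => //; rewrite notin_setE /= => /negP xr.
  by rewrite supp // ComplexField.Normc.normc0 powR0.
rewrite esum_fset; last 2 first.
- exact: finite_seq.
- by move=> x _; rewrite lee_fin powR_ge0.
by rewrite -fsbig_seq // sumEFin poweR_EFin.
Qed.

Lemma convolution_seq (T : zmodType) (f g : T -> R[i]) (r s : seq T) (z : T) :
  uniq r -> uniq s -> (forall x, x \notin r -> f x = 0) ->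
  (forall y, y \notin s -> g y = 0) ->
  convolution f g z = \sum_(x <- r) \sum_(y <- s) (x + y == z)%:R * (f x * g y).
Proof.
move=> ur us fr gs; rewrite /convolution.
pose D := [seq xy <- [seq (x, y) | x <- r, y <- s] | xy.1 + xy.2 == z].
rewrite (fsbigE D) /=; last 3 first.
- by rewrite filter_uniq // allpairs_uniq // => -[a b] [c d].
- by move=> xy /=; rewrite mem_filter => /andP[/eqP].
- move=> [x y] /= /eqP xyz; rewrite mem_filter /= xyz /= => xyD.
  have [xr|/fr->] := boolP (x \in r); last by rewrite mul0r.
  have [ys|/gs->] := boolP (y \in s); last by rewrite mulr0.
  by case/negP: xyD; apply: allpairs_f.
rewrite /D big_filter_cond -(big_allpairs
  (F := fun xy => (xy.1 + xy.2 == z)%:R * (f xy.1 * g xy.2))).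
rewrite [LHS]big_mkcond /=; apply: eq_bigr => xy _.
have -> : (xy \in [set xy | xy.1 + xy.2 = z]) = (xy.1 + xy.2 == z).
  by apply/idP/eqP; rewrite in_setE.
by rewrite andbb; case: (_ == _); rewrite ?mul1r ?mul0r.
Qed.

(** With [N] the ell^p norm, every [F x <= N], so
    F x ^2 = F x ^p F x ^(2-p) <= F x ^p N^(2-p). *)
Lemma l2_le_lp (T : eqType) (r : seq T) (F : T -> R) (p : R) :
  1 <= p <= 2 -> (forall x, 0 <= F x) ->
  \sum_(x <- r) F x ^+ 2 <= ((\sum_(x <- r) F x `^ p) `^ p^-1) ^+ 2.
Proof.
move=> /andP[p1 p2] F0; have p0 : 0 < p := lt_le_trans ltr01 p1.
set S := \sum_(x <- r) F x `^ p; set N := S `^ p^-1.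
have S0 : 0 <= S by apply: sumr_ge0 => x _; apply: powR_ge0.
have NpS : N `^ p = S by rewrite /N -powRrM mulVf ?gt_eqF // powRr1.
have two x : 0 <= x -> x ^+ 2 = x `^ p * x `^ (2 - p).
  move=> x0; rewrite -powRD; first by rewrite addrC subrK powR_mulrn.
  by rewrite addrC subrK pnatr_eq0.
have FN x : x \in r -> F x <= N.
  move=> xr; have -> : F x = (F x `^ p) `^ p^-1 by rewrite -powRrM mulfV ?gt_eqF // powRr1.
  apply: ge0_ler_powR; rewrite ?nnegrE ?powR_ge0 ?invr_ge0 ?(ltW p0) //.
  rewrite /S (big_rem x) //= lerDl; apply: sumr_ge0 => y _; exact: powR_ge0.
rewrite two ?powR_ge0 // NpS {1}/S mulr_suml big_seq [leRHS]big_seq.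
apply: ler_sum => x xr; rewrite two //; apply: ler_wpM2l; first exact: powR_ge0.
by apply: ge0_ler_powR; rewrite ?nnegrE ?powR_ge0 ?subr_ge0 // FN.
Qed.

(** With a = 2^(eps/3), Bernoulli's inequality bounds [j + 2] by a
    multiple of a^j, and a^(6 j) = (2^j)^(2 eps). *)
Lemma sixth_power_le_powR (eps : R) : 0 < eps -> exists2 c : R, 0 < c &
  forall j n : nat, (2 ^ j <= n)%N -> j.+2%:R ^+ 6 <= c * (n%:R `^ eps) ^+ 2.
Proof.
move=> e0; pose a : R := 2 `^ (eps / 3).
have a1 : 1 < a.
  have e3 : 0 < eps / 3 by rewrite divr_gt0.
  rewrite lt_neqAle eq_sym powR_eq1 (gt_eqF e3) orbF negb_or pnatr_eq1 ltrn0 /=.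
  by rewrite -(powRr0 2) ler_powR ?ler1n // ltW.
have a10 : 0 < a - 1 by rewrite subr_gt0.
pose c := 2 + (a - 1)^-1.
have c0 : 0 < c by rewrite addr_gt0 ?invr_gt0.
have bern j : 1 + j%:R * (a - 1) <= a ^+ j.
  elim: j => [|j IH]; first by rewrite mul0r addr0 expr0.
  rewrite exprS; apply: le_trans (ler_wpM2l (ltW (lt_trans ltr01 a1)) IH).
  have : 0 <= j%:R * (a - 1) ^+ 2 by rewrite mulr_ge0 ?ler0n ?sqr_ge0.
  rewrite -(natr1 j); nra.
have lin j : j.+2%:R <= c * a ^+ j.
  apply: le_trans (ler_wpM2l (ltW c0) (bern j)).
  have ca : c * (a - 1) = 2 * (a - 1) + 1.
    by rewrite /c mulrDl mulVf // gt_eqF.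
  have -> : c * (1 + j%:R * (a - 1)) = c + j%:R * (c * (a - 1)) by ring.
  rewrite ca -addn2 natrD.
  have j0 : 0 <= j%:R * (a - 1) by rewrite mulr_ge0 // ltW.
  have c2 : 2 <= c by rewrite lerDl invr_ge0 ltW.
  lra.
exists (c ^+ 6); first by rewrite exprn_gt0.
move=> j n jn; apply: (@le_trans _ _ ((c * a ^+ j) ^+ 6)).
  by rewrite ler_pXn2r ?nnegrE // mulr_ge0 ?(ltW c0) // exprn_ge0 // powR_ge0.
rewrite exprMn ler_wpM2l ?exprn_ge0 ?(ltW c0) //.
have -> : (a ^+ j) ^+ 6 = ((2 ^ j)%:R `^ eps) ^+ 2.
  rewrite -exprM -(powR_mulrn (j * 6)) ?powR_ge0 // -powRrM.
  rewrite -(powR_mulrn 2) ?powR_ge0 // natrX -(powR_mulrn j) ?ler0n // -!powRrM.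
  by congr (_ `^ _); rewrite natrM; field.
rewrite ler_pXn2r ?nnegrE ?powR_ge0 // ge0_ler_powR ?nnegrE ?ler0n ?ler_nat //.
exact: ltW.
Qed.

End Norms.

Lemma convolution_le_density (R : realType) (V : zmodType) (X Y : {fset V})
    (f g : V -> R[i]) (z : V) :
  (forall x, x \notin X -> f x = 0) -> (forall y, y \notin Y -> g y = 0) ->
  normc (convolution f g z) <=
    sum_density (fun x : X => val x) (fun y : Y => val y)
      (fun x => normc (f (val x))) (fun y => normc (g (val y))) z.
Proof.
move=> fX gY; rewrite (convolution_seq z (fset_uniq X) (fset_uniq Y) fX gY).
rewrite /sum_density big_seq_fsetE /=; apply: le_trans (normc_sum _ _) _.
apply: ler_sum => x _; rewrite big_seq_fsetE /=; apply: le_trans (normc_sum _ _) _.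
apply: ler_sum => y _; case: (_ == _); last by rewrite !mul0r ComplexField.Normc.normc0.
by rewrite !mul1r ComplexField.Normc.normcM.
Qed.

Theorem threefold_convolution_le (R : realType) : exists2 K : R, 0 < K &
  forall (Sigma Sigma' : set 'cV[R]_5)
    (X Y : {fset 'cV[R]_5}) (f g : 'cV[R]_5 -> R[i]) (J : nat) (Z : seq 'cV[R]_5),
  quadratic_threefold Sigma -> quadratic_threefold Sigma' ->
  [set` X] `<=` Sigma -> [set` Y] `<=` Sigma' ->
  (forall x, x \notin X -> f x = 0) -> (forall y, y \notin Y -> g y = 0) ->
  (#|` X| <= 2 ^ J)%N -> (#|` Y| <= 2 ^ J)%N -> (0 < J)%N ->
  uniq Z -> (forall x y, x \in X -> y \in Y -> x + y \in Z) ->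
  \sum_(z <- Z) normc (convolution f g z) ^+ 2 <=
    K * J.+1%:R ^+ 6 *
    ((\sum_(x <- X) normc (f x) ^+ 2) * (\sum_(y <- Y) normc (g y) ^+ 2)).
Proof.
(* 4104 comes from the energy bound, 25 = 5 * 5 from the dyadic majorants. *)
exists (25 * 4104); first exact: (mulr_gt0 (ltr0Sn R 24) (ltr0Sn R 4103)).
move=> Sigma Sigma' X Y f g J Z.
move=> qS qS' XS YS fX gY cX cY J0 uZ XYZ.
rewrite [in leRHS]big_seq_fsetE [X in _ * (_ * X)]big_seq_fsetE /=.
set SF := \sum_(x : X) _; set SG := \sum_(y : Y) _.
have SF0 : 0 <= SF by apply: sumr_ge0 => x _; apply: sqr_ge0.
have SG0 : 0 <= SG by apply: sumr_ge0 => x _; apply: sqr_ge0.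
have energies (S : set 'cV[R]_5) (W : {fset 'cV[R]_5}) : quadratic_threefold S ->
    [set` W] `<=` S -> (#|` W| <= 2 ^ J)%N -> forall A : {set W},
    (energy (fun x : W => val x) A)%:R <= (4104 * J.+1 ^ 4)%:R * #|A|%:R ^+ 2 :> R.
  move=> qW WS cW A; rewrite -natrX -natrM ler_nat.
  apply: (threefold_energy_le qW val_inj _ _ J0); last by rewrite -cardfE.
  by move=> x; apply: WS => /=; apply: valP.
have K0 : 0 <= (4104 * J.+1 ^ 4)%:R :> R := ler0n _ _.
apply: (@le_trans _ _ (\sum_(z <- Z) sum_density (fun x : X => val x) (fun y : Y => val y)
      (fun x => normc (f (val x))) (fun y => normc (g (val y))) z ^+ 2)).
  apply: ler_sum => z _; have := convolution_le_density z fX gY => le.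
  by rewrite ler_pXn2r ?nnegrE ?normc_ge0 // (le_trans (normc_ge0 _) le).
have := @sum_density_le R _ X Y (fun x => val x) (fun y => val y) _ J
  (fun x => normc (f (val x))) (fun y => normc (g (val y))) (Num.sqrt SF) (Num.sqrt SG) Z
  (energies _ _ qS XS cX) (energies _ _ qS' YS cY).
rewrite -!cardfE !sqr_sqrtr // => /(_ cX cY K0).
move=> H; apply: le_trans (H _ _ _ _ _ _ _ _) _ => //.
- by move=> x; apply: normc_ge0.
- by move=> x; apply: normc_ge0.
- by move=> x y; apply: XYZ; apply: valP.
by rewrite natrM natrX le_eqVlt; apply/orP; left; apply/eqP; ring.
Qed.

Theorem corollary5p7 (R : realType) (eps p q : R) (eps_gt0 : 0 < eps)
    (hp : 1 <= p <= 2) (hq : 1 <= q <= 2) (hpq : 1 <= p^-1 + q^-1) :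
  exists2 C : R, 0 < C &
    forall (Sigma Sigma' : set 'cV[R]_5) (X Y : {fset 'cV[R]_5})
           (f g : 'cV[R]_5 -> R[i]),
      quadratic_threefold Sigma -> quadratic_threefold Sigma' ->
      [set` X] `<=` Sigma -> [set` Y] `<=` Sigma' ->
      (forall x, x \notin X -> f x = 0) ->
      (forall y, y \notin Y -> g y = 0) ->
      (lpnorm 2 (convolution f g) <=
        (C * ((#|` X| * #|` Y|)%N%:R `^ eps))%:E * lpnorm p f * lpnorm q g)%E.
Proof.
have [K K0 convolution_le] := threefold_convolution_le R.
have [c c0 cP] := sixth_power_le_powR eps_gt0.
have C0 : 0 < K * c by rewrite mulr_gt0.
exists (Num.sqrt (K * c)); first by rewrite sqrtr_gt0.
move=> Sigma Sigma' X Y f g qS qS' XS YS fX gY.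
have nz (r : R) : 1 <= r <= 2 -> r != 0.
  by move=> /andP[r1 _]; rewrite gt_eqF // (lt_le_trans ltr01 r1).
pose Z := undup [seq x + y | x <- X, y <- Y].
have XYZ x y : x \in X -> y \in Y -> x + y \in Z.
  by move=> xX yY; rewrite mem_undup; apply: allpairs_f.
have convZ z : z \notin Z -> convolution f g z = 0.
  move=> zZ; rewrite (convolution_seq z (fset_uniq X) (fset_uniq Y) fX gY).
  rewrite big_seq big1 // => x xX; rewrite big_seq big1 // => y yY.
  by case: eqP => [xyz|]; rewrite ?mul0r //; rewrite -xyz XYZ in zZ.
rewrite (lpnorm_seq (r := Z)) ?undup_uniq // ?pnatr_eq0 //.
rewrite (lpnorm_seq (r := X)) ?fset_uniq ?nz // (lpnorm_seq (r := Y)) ?fset_uniq ?nz //.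
rewrite -!EFinM lee_fin; set Np := _ `^ p^-1; set Nq := _ `^ q^-1.
have two (z : R[i]) : normc z `^ 2 = normc z ^+ 2 by rewrite powR_mulrn ?normc_ge0.
under eq_bigr do rewrite two.
set S := \sum_(z <- Z) _; set Pi := (#|` X| * #|` Y|)%N.
have S0 : 0 <= S by apply: sumr_ge0 => z _; apply: sqr_ge0.
rewrite powR12_sqrt //.
have rhs0 : 0 <= Num.sqrt (K * c) * Pi%:R `^ eps * Np * Nq.
  by do !apply: mulr_ge0; rewrite ?sqrtr_ge0 ?powR_ge0.
rewrite -(@ler_pXn2r _ 2) ?nnegrE ?sqrtr_ge0 // sqr_sqrtr // !exprMn sqr_sqrtr ?(ltW C0) //.
have fp : \sum_(x <- X) normc (f x) ^+ 2 <= Np ^+ 2.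
  by apply: (@l2_le_lp R _ X (fun x => normc (f x)) p hp) => x; apply: normc_ge0.
have gq : \sum_(y <- Y) normc (g y) ^+ 2 <= Nq ^+ 2.
  by apply: (@l2_le_lp R _ Y (fun y => normc (g y)) q hq) => y; apply: normc_ge0.
(* The logarithm below needs Pi > 0; otherwise X or Y is empty and the
   convolution vanishes. *)
have [Pi0|Pi_gt0] := posnP Pi.
  have -> : S = 0; last by rewrite !mulr_ge0 ?powR_ge0 ?(ltW K0) ?(ltW c0).
  rewrite /S big1 // => z _; rewrite (convolution_seq z (fset_uniq X) (fset_uniq Y) fX gY).
  have -> : \sum_(x <- X) \sum_(y <- Y) (x + y == z)%:R * (f x * g y) = 0.
    rewrite big_seq big1 // => x xX; rewrite big_seq big1 // => y yY.
    move/eqP: Pi0; rewrite muln_eq0 !cardfs_eq0 => /orP[] /eqP E.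
      by rewrite E in xX.
    by rewrite E in yY.
  by rewrite ComplexField.Normc.normc0 expr0n.
pose j := trunc_log 2 Pi.
have Pi_lt : (Pi < 2 ^ j.+1)%N by apply: trunc_log_ltn.
have [X_gt0 Y_gt0] : (0 < #|` X|)%N /\ (0 < #|` Y|)%N.
  by apply/andP; rewrite -muln_gt0.
have cX : (#|` X| <= 2 ^ j.+1)%N by apply: leq_trans (ltnW Pi_lt); rewrite leq_pmulr.
have cY : (#|` Y| <= 2 ^ j.+1)%N by apply: leq_trans (ltnW Pi_lt); rewrite leq_pmull.
have := convolution_le _ _ _ _ _ _ _ _ qS qS' XS YS fX gY cX cY isT (undup_uniq _) XYZ.
move=> /le_trans; apply.
have -> : K * c * (Pi%:R `^ eps) ^+ 2 * Np ^+ 2 * Nq ^+ 2 =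
    K * (c * (Pi%:R `^ eps) ^+ 2) * (Np ^+ 2 * Nq ^+ 2) by ring.
apply: ler_pM.
- by apply: mulr_ge0; [exact: ltW|apply: exprn_ge0].
- by apply: mulr_ge0; apply: sumr_ge0 => ? _; apply: sqr_ge0.
- by apply: ler_wpM2l; [exact: ltW|exact: cP (trunc_logP (isT : 1 < 2)%N Pi_gt0)].
by apply: ler_pM fp gq; apply: sumr_ge0 => ? _; apply: sqr_ge0.
Qed.
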